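(* Let $\Theta$ be an $n\times n$ matrix inner function, $p\in(2,\infty]$, and let $G\in L^{(p,n\times n)}$ be such that $A_G^\Theta$ is a MTTO. Then $\ker A_G^\Theta$ is nearly $S^*$-invariant with defect $m$ for some $m\le n$; that is, there is a subspace $D\subseteq(H^2)^n$ with $\dim D=m\le n$ such that whenever $f\in\ker A_G^\Theta$ and $f(0)=0$, we have $S^*f\in\ker A_G^\Theta+D$.
   Context: $\mathbb T$ is the unit circle; $L^p,H^p$ are Lebesgue/Hardy spaces on $\mathbb T$; $(L^p)^n,(H^p)^n$ are length-$n$ column vectors with entries in these spaces; $L^{(p,n\times n)}$ is the space of $n\times n$ matrices with entries in $L^p$. An $n\times n$ matrix inner function is an $n\times n$ matrix $\Theta$ with $H^\infty$ entries and $\Theta(z)$ unitary a.e. on $\mathbb T$. $K^2_\Theta=(H^2)^n\ominus\Theta(H^2)^n$ is the model space and $P_{\Theta,2}$ the orthogonal projection of $(L^2)^n$ onto it. MTTO: for $G\in L^{(2,n\times n)}$ consider $f\mapsto P_{\Theta,2}(Gf)$ on $K^2_\Theta\cap(H^\infty)^n$, which is dense in $K^2_\Theta$; when this map is bounded in the $L^2$ norm, its bounded extension $A_G^\Theta:K^2_\Theta\to K^2_\Theta$ is called a MTTO. The backward shift is $S^*f=(f-f(0))/z$. *)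

(* Defs.v *)
(* mathcomp-analysis (Lebesgue measure/integral, Lnorm)
   + real-closed's complex numbers R[i]. *)
From HB Require Import structures.
From mathcomp Require Import all_boot all_order all_algebra.
From mathcomp Require Import all_classical all_reals all_analysis.
From mathcomp Require Export complex.
Set Implicit Arguments. Unset Strict Implicit. Unset Printing Implicit Defensive.
Import Order.TTheory GRing.Theory Num.Theory.
Import numFieldNormedType.Exports.
Local Open Scope classical_set_scope.
Local Open Scope ring_scope.
Local Open Scope complex_scope.

Section Hardy.
Context {R : realType}.
Local Notation C := R[i].

(* The unit circle T is parametrised by t in [0, 2 pi] (z = e^{it}),
   with (unnormalised) Lebesgue measure; a function on T is a function
   R -> C, only its values on [0, 2 pi] matter. *)
Definition Tc : set R := `[0%R, 2 * pi]%classic.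

Lemma measurable_Tc : measurable Tc.
Proof. exact: measurable_itv. Qed.

(* Lebesgue measure restricted to T *)
Definition muT := mrestr (@lebesgue_measure R) measurable_Tc.

Definition cmod (z : C) : R := Num.sqrt (complex.Re z ^+ 2 + complex.Im z ^+ 2).

Definition expi (x : R) : C := cos x +i* sin x.

Definition cmeasurable (f : R -> C) :=
  measurable_fun Tc (fun t => complex.Re (f t)) /\ measurable_fun Tc (fun t => complex.Im (f t)).

(* f in L^p(T), p in \bar R (p = +oo allowed) *)
Definition inL (p : \bar R) (f : R -> C) :=
  cmeasurable f /\ (Lnorm muT p (fun t => (cmod (f t))%:E) < +oo)%E.

(* integral over T of a complex function *)
Definition cint (f : R -> C) : C :=
  (Rintegral lebesgue_measure Tc (fun t => complex.Re (f t)))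
  +i* (Rintegral lebesgue_measure Tc (fun t => complex.Im (f t))).

(* k-th Fourier coefficient *)
Definition fourier (f : R -> C) (k : int) : C :=
  ((2 * pi)^-1)%:C * cint (fun t => f t * expi (- (k%:~R * t))).

(* H^p: L^p functions with vanishing negative Fourier coefficients *)
Definition inH (p : \bar R) (f : R -> C) :=
  inL p f /\ forall k : nat, fourier f (Negz k) = 0.

Variable n : nat.

Definition comp (u : R -> 'cV[C]_n) (i : 'I_n) : R -> C := fun t => u t i 0.

Definition inLn (p : \bar R) (u : R -> 'cV[C]_n) := forall i, inL p (comp u i).
Definition inHn (p : \bar R) (u : R -> 'cV[C]_n) := forall i, inH p (comp u i).
Definition inLmx (p : \bar R) (G : R -> 'M[C]_n) :=
  forall i j, inL p (fun t => G t i j).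

Definition adjmx (M : 'M[C]_n) : 'M[C]_n := map_mx (fun z => z^*) M^T.

(* n x n matrix inner function *)
Definition is_matrix_inner (Th : R -> 'M[C]_n) :=
  (forall i j, inH +oo (fun t => Th t i j)) /\
  {ae (@lebesgue_measure R), forall t, Tc t ->
     Th t *m adjmx (Th t) = 1%:M /\ adjmx (Th t) *m Th t = 1%:M}.

(* inner product and norm of (L^2)^n *)
Definition ip (u v : R -> 'cV[C]_n) : C :=
  cint (fun t => \sum_i u t i 0 * (v t i 0)^*).

Definition l2norm (u : R -> 'cV[C]_n) : R :=
  Num.sqrt (Rintegral lebesgue_measure Tc (fun t => \sum_i cmod (u t i 0) ^+ 2)).

Definition mulfun (Th : R -> 'M[C]_n) (h : R -> 'cV[C]_n) : R -> 'cV[C]_n :=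
  fun t => Th t *m h t.

(* model space K^2_Th = (H^2)^n (-) Th (H^2)^n *)
Definition inK (Th : R -> 'M[C]_n) (f : R -> 'cV[C]_n) :=
  inHn 2%:E f /\ forall h, inHn 2%:E h -> ip f (mulfun Th h) = 0.

(* v = P_{Th,2} u : the orthogonal projection of u onto K^2_Th *)
Definition projK (Th : R -> 'M[C]_n) (u v : R -> 'cV[C]_n) :=
  inK Th v /\ forall w, inK Th w -> ip (fun t => u t - v t) w = 0.

(* K^2_Th \cap (H^oo)^n *)
Definition inKinf (Th : R -> 'M[C]_n) (f : R -> 'cV[C]_n) :=
  inK Th f /\ inHn +oo f.

(* f |-> P_{Th,2}(G f) is bounded in L^2 norm on K^2_Th \cap (H^oo)^n *)
Definition is_MTTO (Th G : R -> 'M[C]_n) :=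
  exists c : R, forall f v, inKinf Th f -> projK Th (mulfun G f) v ->
    l2norm v <= c * l2norm f.

Definition l2cvg (u : nat -> R -> 'cV[C]_n) (v : R -> 'cV[C]_n) :=
  l2norm (fun t => u k t - v t) @[k --> \oo] --> (0 : R).

(* A_G^Th f = h for the bounded (continuous) extension A_G^Th *)
Definition MTTO_app (Th G : R -> 'M[C]_n) (f h : R -> 'cV[C]_n) :=
  exists (fk vk : nat -> R -> 'cV[C]_n),
    [/\ forall k, inKinf Th (fk k),
        forall k, projK Th (mulfun G (fk k)) (vk k),
        l2cvg fk f & l2cvg vk h].

(* f in ker A_G^Th *)
Definition inKer (Th G : R -> 'M[C]_n) (f : R -> 'cV[C]_n) :=
  inK Th f /\ MTTO_app Th G f (fun _ => 0).

(* f(0) for f in (H^2)^n : zeroth Fourier coefficient *)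
Definition at0 (f : R -> 'cV[C]_n) : 'cV[C]_n := \col_i fourier (comp f i) 0.

(* backward shift S^* f = (f - f(0)) / z, with 1/z = e^{-it} on T *)
Definition bshift (f : R -> 'cV[C]_n) : R -> 'cV[C]_n :=
  fun t => expi (- t) *: (f t - at0 f).

End Hardy.

(* Main.v *)
Require Import Defs.
From HB Require Import structures.
From mathcomp Require Import all_boot all_order all_algebra.
From mathcomp Require Import all_classical all_reals all_analysis.
From mathcomp Require Import measurable_realfun ess_sup_inf.
From mathcomp Require Import complex ring lra.
Set Implicit Arguments. Unset Strict Implicit. Unset Printing Implicit Defensive.
Import Order.TTheory GRing.Theory Num.Theory.
Import numFieldNormedType.Exports.
Local Open Scope classical_set_scope.
Local Open Scope ring_scope.
Local Open Scope complex_scope.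

(* Let f be in the kernel with f(0) = 0, approximated by bounded f_k in the
   model space K with v_k = P(G f_k) -> 0. A continuous linear functional that
   vanishes at the limit can be made to vanish on the approximants, by
   subtracting small multiples of one fixed approximant; so one may assume
   f_k(0) = v_k(0) = 0. If moreover the n coefficients <G f_k, Th e_j> vanish,
   then P(G f_k / z) = v_k / z: for w in K, z w = w' + Th b with w' in K and b
   constant, hence <G f_k / z - v_k / z, w> = <G f_k - v_k, w' + Th b> = 0.
   Then f / z is in the kernel. Finally, restricting a subspace to the kernel
   of one linear functional, continuous or not, shrinks its closure by a
   codimension of at most one, so the n conditions cost a defect of at most n. *)

(** * Functions on the circle *)

Section ScalarFunctions.
Context {R : realType}.
Local Notation C := R[i].
Local Notation mu := (@lebesgue_measure R).
Implicit Types (f g h : R -> C) (z w : C).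

(** The obstacle is that f -> <G f, Th e_j> need not be continuous in the L^2 norm: G may be
    unbounded and the f_k converge to f only in L^2, so these coefficients cannot be read off from
    f. The conditions at 0 are continuous and cost nothing; only these n coefficients can produce a
    defect.

    All approximation takes place among pairs. The operator enters through the graph of f -> P(G f)
    on bounded f, and the kernel consists of the f with (f, 0) in the closure of that graph.
    Division by z is an isometry, so once it maps a subspace of the graph into the graph, it does
    the same for closures.

    The codimension bound rests on a dichotomy. The kernel of an unbounded functional is dense in
    its domain; a bounded functional extends to the closure, and one vector on which the extension
    is nonzero corrects all the others. The defect space is therefore spanned by vectors d_j / z,
    where the d_j lie in the kernel and vanish at 0; they are obtained by choice, not by a
    formula. *)

Definition sqm (z : C) : R := complex.Re z ^+ 2 + complex.Im z ^+ 2.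

Lemma sqm_ge0 z : 0 <= sqm z.
Proof. by rewrite addr_ge0// sqr_ge0. Qed.

Lemma sqr_cmod z : cmod z ^+ 2 = sqm z.
Proof. by rewrite sqr_sqrtr// sqm_ge0. Qed.

Lemma sqmM z w : sqm (z * w) = sqm z * sqm w.
Proof. case: z w => [a b] [c d]; rewrite /sqm /=; ring. Qed.

Lemma sqmJ z : sqm z^* = sqm z.
Proof. by case: z => a b; rewrite /sqm /= sqrrN. Qed.

Lemma sqmN z : sqm (- z) = sqm z.
Proof. by case: z => a b; rewrite /sqm /= !sqrrN. Qed.

(** Squared moduli keep all estimates polynomial. The factor 2 replaces the triangle inequality and
    is harmless, since only smallness matters later. *)
Lemma sqmD_le z w : sqm (z + w) <= 2 * (sqm z + sqm w).
Proof.
case: z w => [a b] [c d]; rewrite /sqm /=.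
have := sqr_ge0 (a - c); have := sqr_ge0 (b - d); rewrite !sqrrD !sqrrN; nra.
Qed.

Lemma sqm_expi t : sqm (expi t) = 1 :> R.
Proof. by rewrite /sqm /= cos2Dsin2. Qed.

Lemma ReM z w : complex.Re (z * w) = complex.Re z * complex.Re w - complex.Im z * complex.Im w.
Proof. by case: z w => [a b] [c d]. Qed.

Lemma ImM z w : complex.Im (z * w) = complex.Re z * complex.Im w + complex.Im z * complex.Re w.
Proof. by case: z w => [a b] [c d]. Qed.

Lemma ReD z w : complex.Re (z + w) = complex.Re z + complex.Re w.
Proof. by case: z w => [a b] [c d]. Qed.

Lemma ImD z w : complex.Im (z + w) = complex.Im z + complex.Im w.
Proof. by case: z w => [a b] [c d]. Qed.

Lemma ReJ z : complex.Re z^* = complex.Re z.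
Proof. by case: z. Qed.

Lemma ImJ z : complex.Im z^* = - complex.Im z.
Proof. by case: z. Qed.

Lemma expiD s t : expi (s + t) = expi s * expi t :> C.
Proof. by apply/eqP; rewrite eq_complex /= cosD sinD; apply/andP; split; apply/eqP; ring. Qed.

Lemma expi0 : expi 0 = 1 :> C.
Proof. by rewrite /expi cos0 sin0. Qed.

Lemma expiN t : expi (- t) = (expi t)^* :> C.
Proof. by rewrite /expi cosN sinN. Qed.

Lemma expiVl t : expi (- t) * expi t = 1 :> C.
Proof. by rewrite -expiD addNr expi0. Qed.

Lemma aeS (P Q : R -> Prop) : (forall t, P t -> Q t) ->
  {ae mu, forall t, P t} -> {ae mu, forall t, Q t}.
Proof. by move=> PQ h; apply: filterS h => //; exact: (ae_filter_ringOfSetsType mu). Qed.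

Lemma aeS2 (P Q S : R -> Prop) : (forall t, P t -> Q t -> S t) ->
  {ae mu, forall t, P t} -> {ae mu, forall t, Q t} -> {ae mu, forall t, S t}.
Proof. by move=> PQS h k; apply: filterS2 h k => //; exact: (ae_filter_ringOfSetsType mu). Qed.

Lemma cmeasD f g : cmeasurable f -> cmeasurable g -> cmeasurable (fun t => f t + g t).
Proof.
move=> [rf jf] [rg jg]; split; under eq_fun do rewrite ?ReD ?ImD; exact: measurable_funD.
Qed.

Lemma cmeasM f g : cmeasurable f -> cmeasurable g -> cmeasurable (fun t => f t * g t).
Proof.
move=> [rf jf] [rg jg]; split; under eq_fun do rewrite ?ReM ?ImM.
  by apply: measurable_funB; exact: measurable_funM.
by apply: measurable_funD; exact: measurable_funM.
Qed.

Lemma cmeasJ f : cmeasurable f -> cmeasurable (fun t => (f t)^*).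
Proof.
move=> [rf jf]; split; first by under eq_fun do rewrite ReJ.
by under eq_fun do rewrite ImJ; exact: measurable_funN.
Qed.

Lemma cmeas_cst z : cmeasurable (fun _ => z).
Proof. by split; exact: measurable_cst. Qed.

Lemma cmeas_expi (k : R) : cmeasurable (fun t => expi (k * t) : C).
Proof.
have mk : measurable_fun (@Tc R) (fun t => k * t) by exact: measurable_funM.
split => /=; apply: (measurableT_comp _ mk); apply: continuous_measurable_fun.
  exact: continuous_cos.
exact: continuous_sin.
Qed.

Lemma measurable_sqm f : cmeasurable f -> measurable_fun (@Tc R) (fun t => sqm (f t)).
Proof. by move=> [rf jf]; apply: measurable_funD; exact: measurable_funX. Qed.

(** [L2] and [Linf] are working forms of [inL] at 2 and +oo, free of [Lnorm]; the bound in [Linf] is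
    on the squared modulus. The equivalences are [inL2P] and [inLooP]. *)
Definition L2 f := cmeasurable f /\ mu.-integrable (@Tc R) (EFin \o (fun t => sqm (f t))).

Definition Linf f := cmeasurable f /\
  exists M : R, {ae mu, forall t, Tc t -> sqm (f t) <= M}.

Definition L1 f := mu.-integrable (@Tc R) (EFin \o (fun t => complex.Re (f t))) /\
  mu.-integrable (@Tc R) (EFin \o (fun t => complex.Im (f t))).

Let mTc : measurable (Tc : set (measurableTypeR R)) := @measurable_Tc R.

Lemma mu_Tc : (mu Tc = (2 * pi)%:E)%E.
Proof.
by rewrite /Tc lebesgue_measure_itv /= lte_fin mulr_gt0 ?pi_gt0//= sube0.
Qed.

Lemma cmeas_L1 f : L1 f -> cmeasurable f.
Proof. by move=> [/measurable_int /measurable_EFinP ? /measurable_int /measurable_EFinP ?]. Qed.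

Lemma integrable_le (u v : R -> R) : measurable_fun (@Tc R) u ->
  (forall t, `|u t| <= v t) -> mu.-integrable (@Tc R) (EFin \o v) ->
  mu.-integrable (@Tc R) (EFin \o u).
Proof.
move=> mf uv; apply: le_integrable => //; first exact/measurable_EFinP.
by move=> t _ /=; rewrite lee_fin (le_trans (uv t))// ler_norm.
Qed.

Lemma integrable_add (u v : R -> R) : mu.-integrable (@Tc R) (EFin \o u) ->
  mu.-integrable (@Tc R) (EFin \o v) -> mu.-integrable (@Tc R) (EFin \o (fun t => u t + v t)).
Proof. by move=> iu iv; have := integrableD mTc iu iv. Qed.

Lemma integrable_scale (a : R) (v : R -> R) :
  mu.-integrable (@Tc R) (EFin \o v) -> mu.-integrable (@Tc R) (EFin \o (fun t => a * v t)).
Proof. by move=> iv; have := integrableZl mTc a iv. Qed.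

Lemma L1_cst z : L1 (fun _ => z).
Proof.
have H (a : R) : mu.-integrable (@Tc R) (EFin \o (fun _ => a)).
  apply: measurable_bounded_integrable => //; first by rewrite [X in (X < _)%E]mu_Tc ltry.
  by exists `|a|; split => // x ax t _ /=; exact: ltW.
by split; exact: H.
Qed.

Lemma L1D f g : L1 f -> L1 g -> L1 (fun t => f t + g t).
Proof.
by move=> [rf jf] [rg jg]; split; under eq_fun do rewrite ?ReD ?ImD; exact: integrable_add.
Qed.

Lemma L1Z z f : L1 f -> L1 (fun t => z * f t).
Proof.
case: z => a b [rf jf]; split; under eq_fun do rewrite ?ReM ?ImM /=.
  under eq_fun do rewrite -mulNr; by apply: integrable_add; exact: integrable_scale.
by apply: integrable_add; exact: integrable_scale.
Qed.

Lemma L1J f : L1 f -> L1 (fun t => (f t)^*).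
Proof.
move=> [rf jf]; split; first by under eq_fun do rewrite ReJ.
under eq_fun do rewrite ImJ; have := integrable_scale (-1) jf.
by under eq_fun do rewrite mulN1r.
Qed.

(** Domination: each part of the product is a sum of two real products, and 2|xy| <= x^2 + y^2
    bounds it by [sqm (f t) + sqm (g t)]. *)
Lemma L2_mul f g : L2 f -> L2 g -> L1 (fun t => f t * g t).
Proof.
move=> [mf jf] [mg jg]; have [rm jm] := cmeasM mf mg.
have I := integrable_add jf jg; split; apply: (integrable_le _ _ I) => // t;
  rewrite ?ReM ?ImM /sqm; move: (f t) (g t) => [a b] [c d] /=.
  have := sqr_ge0 (a - c); have := sqr_ge0 (a + c).
  have := sqr_ge0 (b - d); have := sqr_ge0 (b + d).
  rewrite ler_norml; nra.
have := sqr_ge0 (a - d); have := sqr_ge0 (a + d).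
have := sqr_ge0 (b - c); have := sqr_ge0 (b + c).
rewrite ler_norml; nra.
Qed.

Lemma L2_cst z : L2 (fun _ => z).
Proof. by split; [exact: cmeas_cst|case: (L1_cst (sqm z)%:C)]. Qed.

Lemma L2_L1 f : L2 f -> L1 f.
Proof. by move=> /(L2_mul (L2_cst 1)); under eq_fun do rewrite mul1r. Qed.

Lemma L2D f g : L2 f -> L2 g -> L2 (fun t => f t + g t).
Proof.
move=> [mf jf] [mg jg]; split; first exact: cmeasD.
apply: (integrable_le _ _ (integrable_scale 2 (integrable_add jf jg))).
  by apply: measurable_sqm; exact: cmeasD.
by move=> t; rewrite ger0_norm ?sqm_ge0// sqmD_le.
Qed.

Lemma integrable_ae_le (u v : R -> R) : measurable_fun (@Tc R) u ->
  (forall t, 0 <= u t) -> {ae mu, forall t, Tc t -> u t <= v t} ->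
  (forall t, 0 <= v t) -> mu.-integrable (@Tc R) (EFin \o v) ->
  mu.-integrable (@Tc R) (EFin \o u).
Proof.
move=> mf u0 uv v0 /integrableP[mv iv]; apply/integrableP; split; first exact/measurable_EFinP.
apply: le_lt_trans iv; apply: ae_ge0_le_integral => //.
- by apply: measurableT_comp => //; exact/measurable_EFinP.
- exact: measurableT_comp.
by apply: aeS uv => t + Tt /= => /(_ Tt) uvt; rewrite lee_fin !ger0_norm.
Qed.

Lemma L2_mul_Linf f g : Linf f -> L2 g -> L2 (fun t => f t * g t).
Proof.
move=> [mf [M fM]] [mg jg]; split; first exact: cmeasM.
apply: (@integrable_ae_le _ (fun t => `|M| * sqm (g t))) => [|t||t|].
- by apply: measurable_sqm; exact: cmeasM.
- exact: sqm_ge0.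
- apply: aeS fM => t + Tt => /(_ Tt) fMt; rewrite sqmM ler_wpM2r ?sqm_ge0//.
  by rewrite (le_trans fMt)// ler_norm.
- by rewrite mulr_ge0 ?sqm_ge0.
- exact: integrable_scale.
Qed.

Lemma L2Z z f : L2 f -> L2 (fun t => z * f t).
Proof.
apply: L2_mul_Linf; split; first exact: cmeas_cst.
by exists (sqm z); apply: aeW => t _.
Qed.

Lemma L2J f : L2 f -> L2 (fun t => (f t)^*).
Proof. by move=> [mf jf]; split; [exact: cmeasJ|under eq_fun do rewrite sqmJ]. Qed.

Lemma Linf_L2 f : Linf f -> L2 f.
Proof. by move=> /L2_mul_Linf /(_ (L2_cst 1)); under eq_fun do rewrite mulr1. Qed.

Lemma Linf_expi k : Linf (fun t => expi (k * t)).
Proof.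
split; first exact: cmeas_expi.
by exists 1; apply: aeW => t _; rewrite sqm_expi.
Qed.

Lemma LinfD f g : Linf f -> Linf g -> Linf (fun t => f t + g t).
Proof.
move=> [mf [M fM]] [mg [N gN]]; split; first exact: cmeasD.
exists (2 * (M + N)); apply: (aeS2 _ fM gN) => t {}fM {}gN Tt.
by rewrite (le_trans (sqmD_le _ _))// ler_wpM2l// lerD ?fM ?gN.
Qed.

Lemma LinfM f g : Linf f -> Linf g -> Linf (fun t => f t * g t).
Proof.
move=> [mf [M fM]] [mg [N gN]]; split; first exact: cmeasM.
exists (M * N); apply: (aeS2 _ fM gN) => t {}fM {}gN Tt.
by rewrite sqmM ler_pM ?sqm_ge0 ?fM ?gN.
Qed.

Lemma Linf_cst z : Linf (fun _ => z).
Proof.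
split; first exact: cmeas_cst.
by exists (sqm z); apply: aeW => t _.
Qed.

End ScalarFunctions.

(** * Lebesgue classes of the restricted measure in terms of integrals over [Tc] *)

Section LebesgueClasses.
Context {R : realType}.
Local Notation C := R[i].
Local Notation mu := (@lebesgue_measure R).
Implicit Types (f g h : R -> C) (z w : C).
Import HBNNSimple.

Let mTc : measurable (Tc : set (measurableTypeR R)) := @measurable_Tc R.

(** Both sides are suprema over simple functions. Cutting a simple function below u down to [Tc]
    changes it only on a [muT]-null set, and one below the restriction of u is below u because u is
    nonnegative. *)
Lemma integral_muT (u : R -> \bar R) : (forall t, 0 <= u t)%E ->
  (\int[muT]_t u t = \int[mu]_(t in Tc) u t)%E.
Proof.
move=> u0.
have mC : measurable (~` Tc : set (measurableTypeR R)) by exact: measurableC.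
have muTC : muT (~` @Tc R) = 0%E by rewrite /muT /mrestr setICl measure0.
have -> : (\int[mu]_(t in Tc) u t = \int[muT]_(t in Tc) u t)%E.
  by apply: eq_measure_integral => A mA AT; rewrite /muT /= /mrestr setIidl.
apply/eqP; rewrite eq_le ge0_integralTE// ge0_integralE//; apply/andP; split.
    apply: ge_ereal_sup => _ [k /= ku <-].
  have -> : sintegral muT k = sintegral muT (proj_nnsfun k mTc).
    rewrite -mrestrict -integral_nnsfun//.
    have -> : sintegral muT k = (\int[muT]_t (k t)%:E)%E.
      by rewrite integral_nnsfun// patch_setT.
    have mk : measurable_fun setT (EFin \o k) by exact/measurable_EFinP.
    rewrite [LHS](ge0_negligible_integral mC measurableT mk) ?setDE ?setTI ?setCK//.
    by move=> t _; rewrite lee_fin fun_ge0.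
  apply: ereal_sup_ubound; exists (proj_nnsfun k mTc) => // t.
  rewrite -mrestrict /patch; case: ifP => // _; exact: ku.
apply: ereal_sup_le => _ [k /= ku <-]; exists k => // t.
by apply: (le_trans (ku t)); rewrite /patch; case: ifP => // _; exact: u0.
Qed.

Lemma ae_muT (P : R -> Prop) :
  {ae muT, forall t, P t} <-> {ae mu, forall t, Tc t -> P t}.
Proof.
split=> -[A [mA A0 PA]].
  exists (A `&` Tc); split => //; first exact: measurableI.
  move=> t /= /not_implyP[Tt nP]; split => //; exact: PA.
exists (A `|` ~` Tc); split.
- by apply: measurableU => //; exact: measurableC.
- rewrite /muT /= /mrestr setIUl setICl setU0.
  apply/eqP; rewrite eq_le measure_ge0 andbT -A0; apply: le_measure; rewrite ?inE//.
  exact: measurableI.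
- move=> t /= nP; have [Tt|] := pselect (Tc t); last by right.
  by left; apply: PA => /= /(_ Tt).
Qed.

Lemma muT_gt0 : (0 < muT [set: R])%E.
Proof. by rewrite /muT /mrestr setTI [ltRHS]mu_Tc lte_fin mulr_gt0 ?pi_gt0. Qed.

Lemma cmod_ge0 z : 0 <= cmod z :> R.
Proof. exact: sqrtr_ge0. Qed.

Lemma Lnorm_muT_fin (r : R) f : r != 0 -> (Lnorm muT r%:E (fun t => (cmod (f t))%:E) < +oo)%E <->
  (\int[mu]_(t in Tc) (cmod (f t) `^ r)%:E < +oo)%E.
Proof.
move=> r0; rewrite unlock integral_muT; last by move=> t; exact: poweR_ge0.
under eq_integral do rewrite /= ger0_norm ?cmod_ge0//.
by split => [/lty_poweRy->//|/poweR_lty->//]; rewrite invr_eq0.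
Qed.

Lemma inL2P f : inL 2%:E f <-> L2 f.
Proof.
rewrite /inL /L2 Lnorm_muT_fin//.
split => -[mf H]; split => //.
  apply/integrableP; split; first by apply/measurable_EFinP; exact: measurable_sqm.
  by under eq_integral do rewrite /= ger0_norm ?sqm_ge0// -sqr_cmod -powR_mulrn ?cmod_ge0//.
case/integrableP: H => _.
by under eq_integral do rewrite /= ger0_norm ?sqm_ge0// -sqr_cmod -powR_mulrn ?cmod_ge0//.
Qed.

Lemma inLooP f : inL +oo%E f <-> Linf f.
Proof.
rewrite /inL /Linf unlock muT_gt0; split => -[mf H]; split => //.
  have [M /ae_muT HM] := ess_supr_bounded H.
  exists (M ^+ 2); apply: aeS HM => t + Tt => /(_ Tt) /= fM.
  rewrite ger0_norm ?cmod_ge0// in fM.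
  have M0 : 0 <= M by apply: le_trans fM; exact: cmod_ge0.
  by rewrite -sqr_cmod lerXn2r ?nnegrE ?cmod_ge0.
have [M HM] := H.
apply: (@le_lt_trans _ _ (Num.sqrt `|M|)%:E); last exact: ltry.
apply/ess_supP/ae_muT; apply: aeS HM => t + Tt => /(_ Tt) fM /=.
rewrite lee_fin ger0_norm ?cmod_ge0// ler_wsqrtr//.
by rewrite (le_trans _ (ler_norm _)).
Qed.

(** For finite r > 2 the pointwise bound x^2 <= 1 + x^r suffices, because the circle has finite
    measure and so the constant 1 is integrable. *)
Lemma inL_L2 (p : \bar R) f : (2%:E < p)%E -> inL p f -> L2 f.
Proof.
case: p => [r|_ /inLooP/Linf_L2//|//]; rewrite lte_fin => r2 [mf /Lnorm_muT_fin H].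
have r0 : 0 < r by apply: lt_trans r2.
split => //.
have cE t : cmod (f t) `^ r = sqm (f t) `^ (r / 2).
  by rewrite -sqr_cmod -powR_mulrn ?cmod_ge0// -powRrM mulrC divfK.
apply: (@integrable_le _ _ (fun t => 1 + sqm (f t) `^ (r / 2))).
- exact: measurable_sqm.
- move=> t; rewrite -cE ger0_norm ?sqm_ge0// -sqr_cmod.
  have [c1|/ltW c1] := leP (cmod (f t)) 1.
    by rewrite ler_wpDr ?powR_ge0// exprn_ile1 ?cmod_ge0.
  by rewrite ler_wpDl// -powR_mulrn ?cmod_ge0// ler_powR// ltW.
apply: integrable_add; first by case: (L1_cst (1 : C)).
apply/integrableP; split.
  apply/measurable_EFinP; apply: measurableT_comp (measurable_powR _) _.
  exact: measurable_sqm.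
under eq_integral do rewrite /= ger0_norm ?powR_ge0// -cE.
by apply: H; rewrite gt_eqF.
Qed.

End LebesgueClasses.

(** * Integrals and Fourier coefficients *)

Section Fourier.
Context {R : realType}.
Local Notation C := R[i].
Local Notation mu := (@lebesgue_measure R).
Implicit Types (f g h : R -> C) (z w : C).

Let mTc : measurable (Tc : set (measurableTypeR R)) := @measurable_Tc R.

Lemma cintD f g : L1 f -> L1 g -> cint (fun t => f t + g t) = cint f + cint g.
Proof.
move=> [rf jf] [rg jg]; apply/eqP; rewrite eq_complex; apply/andP; split; apply/eqP => /=.
  by rewrite -(RintegralD mTc rf rg); apply: eq_Rintegral => t _; rewrite ReD.
by rewrite -(RintegralD mTc jf jg); apply: eq_Rintegral => t _; rewrite ImD.
Qed.

Lemma cintZ z f : L1 f -> cint (fun t => z * f t) = z * cint f.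
Proof.
case: z => a b [rf jf]; apply/eqP; rewrite eq_complex; apply/andP; split; apply/eqP => /=.
  rewrite -(RintegralZl a mTc rf) -(RintegralZl b mTc jf) -RintegralB//;
    try exact: integrable_scale.
  by apply: eq_Rintegral => t _; case: (f t).
rewrite -(RintegralZl b mTc rf) -(RintegralZl a mTc jf) -RintegralD//;
  try exact: integrable_scale.
by apply: eq_Rintegral => t _; case: (f t) => c d /=; rewrite addrC.
Qed.

Lemma cintJ f : L1 f -> cint (fun t => (f t)^*) = (cint f)^*.
Proof.
move=> [rf jf]; apply/eqP; rewrite eq_complex; apply/andP; split; apply/eqP => /=.
  by apply: eq_Rintegral => t _; rewrite ReJ.
rewrite -mulN1r -(RintegralZl (-1) mTc jf).
by apply: eq_Rintegral => t _; rewrite ImJ mulN1r.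
Qed.

Lemma cint_cst z : cint (fun _ => z) = (2 * pi)%:C * z.
Proof.
case: z => a b; rewrite /cint /= !(Rintegral_cst mu mTc).
have -> : fine (mu (@Tc R)) = 2 * pi by have /= -> := mu_Tc.
by apply/eqP; rewrite eq_complex /= !mul0r subr0 addr0; apply/andP; split; apply/eqP; ring.
Qed.

Lemma cint_ae f g : cmeasurable f -> cmeasurable g ->
  {ae mu, forall t, Tc t -> f t = g t} -> cint f = cint g.
Proof.
move=> [rf jf] [rg jg] fg; rewrite /cint /Rintegral; congr (fine _ +i* fine _).
  apply: ae_eq_integral => //; try exact/measurable_EFinP.
  by apply: aeS fg => t + Tt => /(_ Tt) ->.
apply: ae_eq_integral => //; try exact/measurable_EFinP.
by apply: aeS fg => t + Tt => /(_ Tt) ->.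
Qed.

Lemma L1_sum (I : Type) (s : seq I) (F : I -> R -> C) :
  (forall i, L1 (F i)) -> L1 (fun t => \sum_(i <- s) F i t).
Proof.
move=> LF; elim: s => [|i s IH].
  under eq_fun do rewrite big_nil; exact: L1_cst.
under eq_fun do rewrite big_cons.
by apply: L1D => //; exact: LF.
Qed.

Lemma L2_sum (I : Type) (s : seq I) (F : I -> R -> C) :
  (forall i, L2 (F i)) -> L2 (fun t => \sum_(i <- s) F i t).
Proof.
move=> LF; elim: s => [|i s IH].
  under eq_fun do rewrite big_nil; exact: L2_cst.
under eq_fun do rewrite big_cons.
by apply: L2D => //; exact: LF.
Qed.

Lemma cint_sum (I : Type) (s : seq I) (F : I -> R -> C) :
  (forall i, L1 (F i)) ->
  cint (fun t => \sum_(i <- s) F i t) = \sum_(i <- s) cint (F i).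
Proof.
move=> LF; elim: s => [|i s IH].
  by under eq_fun do rewrite big_nil; rewrite big_nil cint_cst mulr0.
under eq_fun do rewrite big_cons; rewrite big_cons.
by rewrite cintD ?IH//; exact: L1_sum.
Qed.

Definition I2 f : R := Rintegral mu Tc (fun t => sqm (f t)).

Lemma I2_ge0 f : 0 <= I2 f.
Proof. by apply: Rintegral_ge0 => t _; exact: sqm_ge0. Qed.

(** Cauchy-Schwarz against the constant 1: with m the integral of u and p = 2 pi, the integral of (u
    - m / p)^2 is nonnegative. The leading factor 2 arises because the real and imaginary parts are
    each bounded by the whole of [I2 f]. *)
Lemma sqm_cint_le f : L2 f -> sqm (cint f) <= 2 * (2 * pi) * I2 f.
Proof.
move=> Lf; have [rf jf] := L2_L1 Lf; have [mf sf] := Lf.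
have key (u : R -> R) : mu.-integrable (@Tc R) (EFin \o u) ->
    (forall t, u t ^+ 2 <= sqm (f t)) -> Rintegral mu Tc u ^+ 2 <= (2 * pi) * I2 f.
  move=> iu uf; set m := Rintegral mu Tc u; have p0 : 0 < 2 * pi :> R by rewrite mulr_gt0 ?pi_gt0.
  set p := 2 * pi in p0 *.
  have H : 0 <= Rintegral mu Tc (fun t => sqm (f t) + (- (2 * (m / p)) * u t) + (m / p) ^+ 2).
    apply: Rintegral_ge0 => t _; have := uf t; have := sqr_ge0 (u t - m / p); nra.
  have ic (a : R) : mu.-integrable (@Tc R) (EFin \o (fun _ => a)).
    by case: (L1_cst (a%:C)).
  move: H; rewrite RintegralD//; last first.
    by apply: integrable_add => //; exact: integrable_scale.
  rewrite RintegralD//; last exact: integrable_scale.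
  rewrite RintegralZl// (Rintegral_cst mu mTc).
  have -> : fine (mu (@Tc R)) = 2 * pi by have /= -> := mu_Tc.
  rewrite -/(I2 f) -/m => H.
  have pE : p * (m / p) = m by rewrite mulrC divfK// gt_eqF.
  move: H; move: (m / p) pE => q <-; rewrite -/p; nra.
rewrite /sqm [2 * _]mulr_natl mulrnAl mulr2n; apply: lerD; apply: key => // t.
  by rewrite /sqm ler_wpDr ?sqr_ge0.
by rewrite /sqm ler_wpDl ?sqr_ge0.
Qed.

Lemma Rintegral_FTC (F f : R -> R) :
  (forall t, is_derive t (1 : R) F (f t)) -> continuous f ->
  Rintegral mu Tc f = F (2 * pi) - F 0.
Proof.
move=> dF cf; have p0 : 0 < 2 * pi :> R by rewrite mulr_gt0 ?pi_gt0.
have cF : continuous F.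
  by move=> t; apply/differentiable_continuous/derivable1_diffP; case: (dF t).
rewrite /Rintegral (@continuous_FTC2 _ f F)//.
- exact: continuous_subspaceT.
- split; first by move=> t _; case: (dF t).
    apply: cvg_at_right_filter; exact: cF.
  apply: cvg_at_left_filter; exact: cF.
- by move=> t _; rewrite derive1E; case: (dF t).
Qed.

Lemma cos_2pi_int (k : int) : cos (k%:~R * (2 * pi)) = 1 :> R.
Proof.
have H (n : nat) : cos (n%:R * (2 * pi)) = 1 :> R.
  have -> : n%:R * (2 * pi) = 0 + pi *+ 2 *+ n :> R.
    by rewrite add0r -[RHS]mulr_natl -[pi *+ 2]mulr_natl.
  by rewrite (periodicn (@cosD2pi R)) cos0.
by case: k => n; rewrite ?NegzE ?mulrNz ?mulNr ?cosN -pmulrn H.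
Qed.

Lemma sin_2pi_int (k : int) : sin (k%:~R * (2 * pi)) = 0 :> R.
Proof.
have H (n : nat) : sin (n%:R * (2 * pi)) = 0 :> R.
  have -> : n%:R * (2 * pi) = 0 + pi *+ 2 *+ n :> R.
    by rewrite add0r -[RHS]mulr_natl -[pi *+ 2]mulr_natl.
  by rewrite (periodicn (@sinD2pi R)) sin0.
by case: k => n; rewrite ?NegzE ?mulrNz ?mulNr ?sinN -pmulrn H ?oppr0.
Qed.

(** Sine and cosine of c t, divided by c up to sign, are antiderivatives of the two parts and take
    equal values at 0 and 2 pi. *)
Lemma cint_expi (k : int) : k != 0 -> cint (fun t => expi (k%:~R * t) : C) = 0.
Proof.
move=> k0; have c0 : k%:~R != 0 :> R by rewrite intr_eq0.
move: (cos_2pi_int k) (sin_2pi_int k) c0; move: (k%:~R) => c cc sc c0.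
have ck : continuous (fun t : R => c * t) by move=> t; apply: cvgM; [exact: cvg_cst|exact: cvg_id].
have dc t : is_derive t (1 : R) (fun t : R => c * t) c.
  by apply: is_derive_eq; rewrite /GRing.scale /= mulr1.
have dS t : is_derive t (1 : R) (fun t => c^-1 * sin (c * t)) (cos (c * t)).
  have d := @is_derive1_comp _ sin (fun t => c * t) t _ _ (is_derive_sin _) (dc t).
  by apply: is_derive_eq; rewrite /GRing.scale /=; field.
have dC t : is_derive t (1 : R) (fun t => - c^-1 * cos (c * t)) (sin (c * t)).
  have d := @is_derive1_comp _ cos (fun t => c * t) t _ _ (is_derive_cos _) (dc t).
  by apply: is_derive_eq; rewrite /GRing.scale /=; field.
rewrite /cint (Rintegral_FTC dS); last first.
  by move=> t; apply: continuous_comp; [exact: ck|exact: continuous_cos].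
rewrite (Rintegral_FTC dC); last first.
  by move=> t; apply: continuous_comp; [exact: ck|exact: continuous_sin].
by rewrite mulr0 sc cc sin0 cos0 !mulr0 !subrr.
Qed.

Lemma L1_fourier f (k : int) : L2 f -> L1 (fun t => f t * expi (- (k%:~R * t))).
Proof.
move=> Lf; apply: L2_mul => //; apply: Linf_L2.
by under eq_fun do rewrite -mulNr; exact: Linf_expi.
Qed.

Lemma fourierD f g k : L2 f -> L2 g ->
  fourier (fun t => f t + g t) k = fourier f k + fourier g k.
Proof.
move=> Lf Lg; rewrite /fourier -mulrDr -cintD; try exact: L1_fourier.
by under eq_fun do rewrite mulrDl.
Qed.

Lemma fourierZ z f k : L2 f -> fourier (fun t => z * f t) k = z * fourier f k.
Proof.
move=> Lf; rewrite /fourier mulrCA -(cintZ z); last exact: L1_fourier.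
by under eq_fun do rewrite -mulrA.
Qed.

Lemma fourier_cst z k : k != 0 -> fourier (fun _ => z) k = 0.
Proof.
move=> k0; rewrite /fourier cintZ.
  under eq_fun do rewrite -mulNr -mulrNz.
  by rewrite cint_expi ?oppr_eq0// !mulr0.
have := L1_fourier k (L2_cst 1); by under eq_fun do rewrite mul1r.
Qed.

Lemma fourier0E f : fourier f 0 = ((2 * pi)^-1)%:C * cint f.
Proof. by congr (_ * cint _); apply/funext => t; rewrite mul0r oppr0 expi0 mulr1. Qed.

Lemma cint_fourier0 f : cint f = (2 * pi)%:C * fourier f 0.
Proof.
rewrite fourier0E mulrA -rmorphM /= divff ?mul1r//.
by rewrite gt_eqF// mulr_gt0 ?pi_gt0.
Qed.

Lemma fourier_cst0 z : fourier (fun _ => z) 0 = z.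
Proof.
rewrite fourier0E cint_cst mulrA -rmorphM /= mulVf ?mul1r//.
by rewrite gt_eqF// mulr_gt0 ?pi_gt0.
Qed.

Lemma fourier_mul_expi f (k m : int) :
  fourier (fun t => expi (m%:~R * t) * f t) k = fourier f (k - m).
Proof.
congr (_ * cint _); apply/funext => t; rewrite mulrAC mulrC -expiD.
by congr (_ * expi _); rewrite intrB; ring.
Qed.

Definition analytic f := forall k : nat, fourier f (Negz k) = 0.

Lemma analyticD f g : L2 f -> L2 g -> analytic f -> analytic g ->
  analytic (fun t => f t + g t).
Proof. by move=> Lf Lg af ag k; rewrite fourierD// af ag addr0. Qed.

Lemma analyticZ z f : L2 f -> analytic f -> analytic (fun t => z * f t).
Proof. by move=> Lf af k; rewrite fourierZ// af mulr0. Qed.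

Lemma analytic_cst z : analytic (fun _ => z).
Proof. by move=> k; rewrite fourier_cst. Qed.

Lemma analytic_shift f : analytic f -> analytic (fun t => expi t * f t).
Proof.
move=> af k; under eq_fun => t do rewrite -[t in expi t]mul1r -[1]/(1%:~R).
rewrite fourier_mul_expi (_ : _ - _ = Negz k.+1) ?af//.
by rewrite !NegzE -[k.+2]addn1 PoszD opprD.
Qed.

Lemma analytic_bshift f : analytic f -> fourier f 0 = 0 ->
  analytic (fun t => expi (- t) * f t).
Proof.
move=> af f0 k; under eq_fun => t do rewrite -[t in expi (- t)]mul1r -mulNr -[- 1]/((- 1)%:~R).
(* Frequencies move up by one, so the coefficient at -1 ([Negz 0]) becomes the zeroth one; this is
   the only place where f(0) = 0 enters. *)
rewrite fourier_mul_expi opprK; case: k => [|k].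
  by rewrite (_ : _ + 1 = 0).
rewrite (_ : _ + _ = Negz k) ?af//.
by rewrite !NegzE -[k.+2]addn1 PoszD opprD subrK.
Qed.

(** Continuity of f -> f(0) on L^2, in quantitative form: [sqm_cint_le] multiplied by (2 pi)^-2. *)
Lemma sqm_fourier0_le f : L2 f -> sqm (fourier f 0) <= 2 * (2 * pi)^-1 * I2 f.
Proof.
move=> Lf; have p0 : 0 < 2 * pi :> R by rewrite mulr_gt0 ?pi_gt0.
rewrite fourier0E sqmM [X in X * _]/sqm /= expr0n addr0.
have := sqm_cint_le Lf; rewrite -(ler_pM2l (_ : 0 < (2 * pi)^-1 ^+ 2)); last first.
  by rewrite exprn_gt0// invr_gt0.
move=> /le_trans; apply; rewrite le_eqVlt; apply/orP; left; apply/eqP.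
have : 2 * pi != 0 :> R by rewrite gt_eqF.
by move: (2 * pi) => q q0; field.
Qed.

End Fourier.

(** * Closures of kernels of linear functionals *)

Section Adherence.
Context {R : realType} {V : lmodType R[i]}.
Implicit Types (S Q : V -> Prop) (l : V -> R[i]).

Definition submodule S := S 0 /\ forall a x y, S x -> S y -> S (a *: x + y).

(** Linearity is asked only on S because functionals given by integrals are additive only where the
    integrals converge. *)
Definition linear_on S l :=
  forall a x y, S x -> S y -> l (a *: x + y) = a * l x + l y.

Lemma submoduleB S a x y : submodule S -> S x -> S y -> S (x - a *: y).
Proof. by move=> [_ SD] Sx Sy; rewrite addrC -scaleNr; exact: SD. Qed.

Lemma submodule_sum S m (a : nat -> R[i]) (d : nat -> V) :
  submodule S -> (forall j, S (d j)) -> S (\sum_(j < m) a j *: d j).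
Proof.
move=> [S0 SD] Sd; elim/big_ind: _ => // [x y Sx Sy|j _].
  by rewrite -[x]scale1r; exact: SD.
by rewrite -[_ *: _]addr0; exact: SD.
Qed.

Lemma linear_on0 S l : submodule S -> linear_on S l -> l 0 = 0.
Proof.
move=> [S0 _] lS; have := lS 1 0 0 S0 S0.
by rewrite scaler0 addr0 mul1r => /eqP; rewrite eq_sym -subr_eq0 addrK => /eqP.
Qed.

Lemma linear_onB S l a x y : linear_on S l -> S x -> S y ->
  l (x - a *: y) = l x - a * l y.
Proof. by move=> lS Sx Sy; rewrite addrC -scaleNr lS// mulNr addrC. Qed.

(** N stands for a squared norm on the ambient subspace H, hence the factor 2 in [ND] and the factor
    [sqm a] in [NZ]. *)
Variables (H : V -> Prop) (N : V -> R).
Hypothesis sH : submodule H.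
Hypothesis N_ge0 : forall x, 0 <= N x.
Hypothesis ND : forall x y, H x -> H y -> N (x + y) <= 2 * (N x + N y).
Hypothesis NZ : forall a x, H x -> N (a *: x) = sqm a * N x.

Definition adherent S x := H x /\ forall e, 0 < e -> exists u, S u /\ N (u - x) < e.

Lemma HB x y : H x -> H y -> H (x - y).
Proof. by move=> Hx Hy; rewrite -[y]scale1r; apply: submoduleB. Qed.

Lemma HZ a x : H x -> H (a *: x).
Proof. by move=> Hx; case: sH => H0 HD; rewrite -[_ *: _]addr0; exact: HD. Qed.

Lemma NB x y a : H x -> H y -> N (x - a *: y) <= 2 * (N x + sqm a * N y).
Proof.
move=> Hx Hy; rewrite -scaleNr -(sqmN a) -NZ//; apply: ND => //; exact: HZ.
Qed.

Lemma sub_adherent S Q x : (forall u, S u -> Q u) -> adherent S x -> adherent Q x.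
Proof.
by move=> SQ [Hx Sx]; split=> // e /Sx [u [Su ux]]; exists u; split => //; exact: SQ.
Qed.

Lemma adherentB S a x y : submodule S -> (forall u, S u -> H u) ->
  adherent S x -> adherent S y -> adherent S (x - a *: y).
Proof.
move=> sS SH [Hx Sx] [Hy Sy]; split; first exact: submoduleB.
(* [NB] doubles a sum of two errors, so each may be at most e / 4; dividing the second radius by
   [sqm a + 1] absorbs the scalar and stays meaningful when a = 0. *)
move=> e e0; have d0 : 0 < e / 4 by lra.
have c0 : 0 < sqm a + 1 by rewrite ltr_wpDl ?sqm_ge0.
have [u [Su ux]] := Sx _ d0; have [v [Sv vy]] := Sy _ (divr_gt0 d0 c0).
exists (u - a *: v); split; first exact: submoduleB.
rewrite (_ : _ - _ = (u - x) - a *: (v - y)); last first.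
  by rewrite scalerBr !opprB addrACA [RHS]addrACA [- x + _]addrC.
apply: le_lt_trans (NB _ _ _) _; [by apply: HB => //; exact: SH..|].
have : sqm a * N (v - y) <= e / 4.
  apply: (@le_trans _ _ ((sqm a + 1) * N (v - y))).
    by rewrite ler_wpM2r ?N_ge0// lerDl.
  by rewrite mulrC -ler_pdivlMr// ltW.
by lra.
Qed.

(* A fixed [y] with [l y = 1] corrects approximants on which [l] is small. *)
Lemma adherent_ker S l x : submodule S -> (forall u, S u -> H u) -> linear_on S l -> H x ->
  (forall e, 0 < e -> exists u, [/\ S u, N (u - x) < e & sqm (l u) < e]) ->
  adherent (fun u => S u /\ l u = 0) x.
Proof.
move=> sS SH lS Hx ap; split=> // e e0.
have [l0|/existsNP[y0 /not_implyP[Sy0 /eqP ly0]]] := pselect (forall u, S u -> l u = 0).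
  by have [u [Su ux _]] := ap _ e0; exists u; split => //; split => //; exact: l0.
have [y [Sy ly]] : exists y, S y /\ l y = 1.
  exists ((l y0)^-1 *: y0 + 0); split; first by case: sS => S0; apply.
  by rewrite lS//; [rewrite mulVf// (linear_on0 sS lS) addr0|case: sS].
have c0 : 0 < 1 + N y by rewrite ltr_pwDl ?N_ge0.
have d0 : 0 < e / 4 / (1 + N y) by rewrite !divr_gt0.
have [u [Su ux lu]] := ap _ d0.
exists (u - l u *: y); split.
  by split; [exact: submoduleB|rewrite (linear_onB _ lS)// ly mulr1 subrr].
rewrite addrAC; apply: le_lt_trans (NB _ _ _) _; [by apply: HB => //; exact: SH|exact: SH|].
have := ltr_pM2r c0 (N (u - x)) (e / 4 / (1 + N y)); rewrite ux divfK ?gt_eqF// => h1.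
have := ltr_pM2r c0 (sqm (l u)) (e / 4 / (1 + N y)); rewrite lu divfK ?gt_eqF// => h2.
have := N_ge0 y; have := N_ge0 (u - x); have := sqm_ge0 (l u); nra.
Qed.

(** As l x = 0, the value l u = l (u - x) is controlled by N (u - x), so l is small on approximants
    and [adherent_ker] applies. Using 1 + |K| handles every sign of K. *)
Lemma adherent_ker_continuous S l K x : submodule S -> (forall u, S u -> H u) ->
  linear_on H l -> (forall u, H u -> sqm (l u) <= K * N u) ->
  adherent S x -> l x = 0 -> adherent (fun u => S u /\ l u = 0) x.
Proof.
move=> sS SH lH lK [Hx Sx] lx; apply: adherent_ker => //.
  by move=> a u v Su Sv; apply: lH; exact: SH.
move=> e e0; have d0 : 0 < e / (1 + `|K|) by rewrite divr_gt0// ltr_pwDl.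
have [u [Su ux]] := Sx _ d0; exists u; split => //.
  by rewrite (lt_le_trans ux)// ler_pdivrMr ?ltr_pwDl// mulrDr mulr1 lerDl mulr_ge0// ltW.
have -> : l u = l (u - x) by rewrite -[x]scale1r (linear_onB _ lH)// ?lx ?mulr0 ?subr0//; exact: SH.
apply: le_lt_trans (lK _ _) _; first by apply: HB => //; exact: SH.
move: ux; rewrite ltr_pdivlMr ?ltr_pwDl//; apply: le_lt_trans.
rewrite mulrC ler_wpM2l ?N_ge0//; have := ler_norm K; lra.
Qed.

(** The rate is the one produced by approximants chosen within 1 / (k + 1) of a common limit; the
    conclusion is completeness of the reals stated with squares. *)
Lemma cauchy_sqr_cvg (a : nat -> R) (c : R) :
  (forall k m, (a k - a m) ^+ 2 <= c * (k.+1%:R^-1 + m.+1%:R^-1)) ->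
  exists L, forall e, 0 < e -> exists K, forall k, (K <= k)%N -> (a k - L) ^+ 2 < e.
Proof.
move=> ac.
have c0 : 0 <= c by have := ac 0%N 0%N; rewrite subrr expr0n /= invr1; lra.
have small e : 0 < e -> exists K : nat, c * (K.+1%:R^-1 + K.+1%:R^-1) < e.
  move=> e0; exists (Num.bound (2 * c / e)).
  have := archi_boundP (divr_ge0 (mulr_ge0 (ler0n R 2) c0) (ltW e0)).
  move: (Num.bound _) => K; rewrite ltr_pdivrMr// => h.
  have -> (y : R) : c * (y + y) = 2 * c * y by ring.
  rewrite ltr_pdivrMr// (lt_le_trans h)//.
  by rewrite mulrC ler_pM2l// ler_nat.
have mono K k : (K <= k)%N -> c * (K.+1%:R^-1 + k.+1%:R^-1) <= c * (K.+1%:R^-1 + K.+1%:R^-1).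
  by move=> Kk; rewrite ler_wpM2l// lerD2l lef_pV2 ?posrE// ler_nat.
have /cauchy_cvgP cva : cauchy (a @ \oo).
  apply: cauchy_exP => e e0; have [K Kc] := small _ (exprn_gt0 2 e0).
  exists (a K); exists K => // k /= Kk; rewrite /ball /= -(@ltr_pXn2r _ 2)// ?nnegrE ?ltW//.
  by rewrite real_normK ?num_real// (le_lt_trans (ac K k))// (le_lt_trans (mono _ _ Kk)).
exists (lim (a @ \oo)) => e e0.
have d0 : 0 < Num.sqrt e by rewrite sqrtr_gt0.
move/cvgrPdist_lt : cva => /(_ _ d0) [K _ Ka]; exists K => k /Ka /=.
by rewrite distrC -(@ltr_pXn2r _ 2)// ?nnegrE ?ltW// real_normK ?num_real// sqr_sqrtr// ltW.
Qed.

(** Here v is the value at x of the continuous extension of l to the closure of S: along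
    approximants u_k -> x the numbers l u_k form a Cauchy sequence, and their real and imaginary
    parts converge. *)
Lemma bounded_functional_extends S l K x : submodule S -> (forall u, S u -> H u) ->
  linear_on S l -> (forall u, S u -> sqm (l u) <= K * N u) -> adherent S x ->
  exists v, forall e, 0 < e -> exists u, [/\ S u, N (u - x) < e & sqm (l u - v) < e].
Proof.
move=> sS SH lS lK [Hx Sx].
have /choice [u ux] k : exists u, S u /\ N (u - x) < k.+1%:R^-1 by apply: Sx; rewrite invr_gt0.
have Su k : S (u k) by case: (ux k).
have HS k : H (u k - x) by apply: HB => //; exact: SH.
have cau k m : sqm (l (u k) - l (u m)) <= 2 * `|K| * (k.+1%:R^-1 + m.+1%:R^-1).
  have -> : l (u k) - l (u m) = l (u k - 1 *: u m) by rewrite (linear_onB _ lS)// mul1r.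
  apply: le_trans (lK _ _) _; first exact: submoduleB.
  apply: (@le_trans _ _ (`|K| * N (u k - 1 *: u m))).
    by rewrite ler_wpM2r ?N_ge0 ?ler_norm.
  rewrite [2 * _]mulrC -[leRHS]mulrA ler_wpM2l//.
  have -> : u k - 1 *: u m = (u k - x) - 1 *: (u m - x).
    by rewrite !scale1r opprB addrA subrK.
  apply: le_trans (NB _ _ _) _ => //; rewrite ler_wpM2l// /sqm /= expr1n expr0n addr0 mul1r.
  by rewrite lerD// ltW//; case: (ux k); case: (ux m).
have cRe k m : (complex.Re (l (u k)) - complex.Re (l (u m))) ^+ 2 <=
    2 * `|K| * (k.+1%:R^-1 + m.+1%:R^-1).
  apply: le_trans (cau k m); case: (l _) (l _) => [a b] [c d].
  by rewrite /sqm /= lerDl sqr_ge0.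
have cIm k m : (complex.Im (l (u k)) - complex.Im (l (u m))) ^+ 2 <=
    2 * `|K| * (k.+1%:R^-1 + m.+1%:R^-1).
  apply: le_trans (cau k m); case: (l _) (l _) => [a b] [c d].
  by rewrite /sqm /= lerDr sqr_ge0.
have [a aP] := cauchy_sqr_cvg cRe; have [b bP] := cauchy_sqr_cvg cIm.
exists (a +i* b) => e e0; have d0 : 0 < e / 2 by lra.
have [[K1 aK] [K2 bK]] := (aP _ d0, bP _ d0).
pose k := (Num.bound (e^-1) + K1 + K2)%N; exists (u k); split => //.
  apply: (lt_le_trans (ux k).2); rewrite invf_ple ?posrE// ltW//.
  apply: (lt_le_trans (archi_boundP _)); first by rewrite invr_ge0 ltW.
  by rewrite ler_nat /k -addnA leqW// leq_addr.
have := aK k; have := bK k; rewrite {1 3}/k leq_addl addnAC leq_addl => /(_ isT) h1 /(_ isT) h2.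
by move: h1 h2; rewrite /sqm; case: (l (u k)) => c d /=; lra.
Qed.

(** If Q is not already in the closure of the kernel, take any d in Q outside it. Then l is bounded
    on S, since otherwise its kernel would come arbitrarily close to d. So l extends to d and x with
    values v and w. The value v is nonzero, as [adherent_ker] would otherwise put d in the closure,
    and x - (w / v) d has extended value 0. *)
Lemma adherent_ker_codim1 S Q l : submodule S -> (forall u, S u -> H u) ->
  linear_on S l -> submodule Q -> (forall x, Q x -> adherent S x) ->
  exists2 d, Q d & forall x, Q x ->
    exists a, adherent (fun u => S u /\ l u = 0) (x - a *: d).
Proof.
move=> sS SH lS sQ QS.
have [all_ad|/existsNP[d /not_implyP[Qd nad]]] :=
  pselect (forall x, Q x -> adherent (fun u => S u /\ l u = 0) x).
  exists 0; first by case: sQ.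
  by move=> x Qx; exists 0; rewrite scaler0 subr0; exact: all_ad.
exists d => //.
have [K lK] : exists K, forall u, S u -> sqm (l u) <= K * N u.
  apply: contrapT => unb; apply: nad; have [Hd Sd] := QS _ Qd; split => // e e0.
  have d0 : 0 < e / 4 by lra.
  have [u [Su ud]] := Sd _ d0.
  (* Unboundedness supplies a y whose value is huge relative to its norm; the constant is set so
     that the correction (l u / l y) y has squared norm at most e / 4. The + 1 keeps it positive
     when l u = 0. *)
  have [y [Sy ly]] : exists y, S y /\ 4 * (sqm (l u) + 1) / e * N y < sqm (l y).
    apply: contrapT => ny; apply: unb; exists (4 * (sqm (l u) + 1) / e) => y Sy.
    by rewrite leNgt; apply/negP => ly; apply: ny; exists y.
  have s0 : 0 < sqm (l y).
    apply: le_lt_trans ly; rewrite mulr_ge0 ?N_ge0// divr_ge0 ?ltW//.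
    by rewrite mulr_gt0// ltr_wpDl ?sqm_ge0.
  have ly0 : l y != 0 by apply: contraTneq s0 => ->; rewrite /sqm /= expr0n addr0 ltxx.
  exists (u - (l u / l y) *: y); split.
    split; first exact: submoduleB.
    by rewrite (linear_onB _ lS)// divfK// subrr.
  rewrite addrAC; apply: le_lt_trans (NB _ _ _) _; [by apply: HB => //; exact: SH|exact: SH|].
  have sE : sqm (l u / l y) * sqm (l y) = sqm (l u) by rewrite -sqmM divfK.
  move: ly; rewrite mulrAC ltr_pdivrMr// => ly.
  have : sqm (l u / l y) * N y <= e / 4.
    have s1 : 0 < 4 * (sqm (l u) + 1) by rewrite mulr_gt0// ltr_wpDl ?sqm_ge0.
    rewrite -(ler_pM2l s1) mulrCA (le_trans (ler_wpM2l (sqm_ge0 _) (ltW ly)))//.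
    by rewrite mulrA sE; have := sqm_ge0 (l u); nra.
  by lra.
have [v dv] := bounded_functional_extends sS SH lS lK (QS _ Qd).
have v0 : v != 0.
  apply/eqP => v0; apply: nad; apply: adherent_ker => //; first by case: (QS _ Qd).
  by move=> e /dv[u []]; rewrite v0 subr0; exists u.
move=> x Qx; have [w xw] := bounded_functional_extends sS SH lS lK (QS _ Qx).
have [[Hx _] [Hd _]] := (QS _ Qx, QS _ Qd).
exists (w / v); apply: adherent_ker => //; first exact: submoduleB.
move=> e e0; have d0 : 0 < e / 4 by lra.
have c0 : 0 < sqm (w / v) + 1 by rewrite ltr_wpDl ?sqm_ge0.
have [u1 [Su1 ux1 lu1]] := xw _ d0; have [u2 [Su2 ux2 lu2]] := dv _ (divr_gt0 d0 c0).
have le1 : forall s, 0 <= s -> s < e / 4 / (sqm (w / v) + 1) -> sqm (w / v) * s < e / 4.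
  by move=> s s0; rewrite ltr_pdivlMr//; nra.
exists (u1 - (w / v) *: u2); split; first exact: submoduleB.
  rewrite (_ : _ - _ = (u1 - x) - (w / v) *: (u2 - d)); last first.
    by rewrite scalerBr !opprB addrACA [RHS]addrACA [- x + _]addrC.
  apply: le_lt_trans (NB _ _ _) _; [by apply: HB => //; exact: SH..|].
  have := le1 _ (N_ge0 _) ux2; lra.
rewrite (linear_onB _ lS)// (_ : _ - _ = (l u1 - w) + - ((w / v) * (l u2 - v))); last first.
  by rewrite mulrBr divfK//; ring.
apply: le_lt_trans (sqmD_le _ _) _; rewrite sqmN sqmM.
have := le1 _ (sqm_ge0 _) lu2; lra.
Qed.

Lemma submodule_ker_iter S (l : nat -> V -> R[i]) m : submodule S ->
  (forall j, linear_on S (l j)) ->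
  submodule (fun x => S x /\ forall j, (j < m)%N -> l j x = 0).
Proof.
move=> sS lS; split; first by split=> [|j _]; [case: sS|exact: linear_on0 (lS j)].
move=> a x y [Sx lx] [Sy ly]; split; first by case: sS => _; apply.
by move=> j jm; rewrite lS// lx// ly// mulr0 addr0.
Qed.

(** Each condition is imposed on the subspace left by the previous ones; x itself never needs
    correction, because every l j vanishes at it. *)
Lemma adherent_ker_continuous_iter S (l : nat -> V -> R[i]) K m x :
  submodule S -> (forall u, S u -> H u) -> (forall j, linear_on H (l j)) ->
  (forall j u, H u -> sqm (l j u) <= K * N u) ->
  adherent S x -> (forall j, (j < m)%N -> l j x = 0) ->
  adherent (fun u => S u /\ forall j, (j < m)%N -> l j u = 0) x.
Proof.
move=> sS SH lH lK Sx; elim: m => [_|m IH lx].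
  by apply: sub_adherent Sx => u Su; split.
have lS j : linear_on S (l j) by move=> a u v Su Sv; apply: lH; exact: SH.
have {}IH := IH (fun j jm => lx j (ltnW jm)).
have := @adherent_ker_continuous _ (l m) K x (submodule_ker_iter m sS lS)
  (fun u Su => SH _ Su.1) (lH m) (lK m) IH (lx m (ltnSn m)).
apply: sub_adherent => u [[Su lu] lmu]; split => // j.
by rewrite ltnS leq_eqVlt => /predU1P[->//|/lu].
Qed.

(** Induction on m, each functional costing at most one vector. All d_j stay in Q, so the corrected
    vector is again in Q. *)
Lemma adherent_ker_codim S Q (l : nat -> V -> R[i]) m :
  submodule S -> (forall u, S u -> H u) -> (forall j, linear_on S (l j)) ->
  submodule Q -> (forall x, Q x -> adherent S x) ->
  exists2 d : nat -> V, (forall j, Q (d j)) & forall x, Q x -> exists a : nat -> R[i],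
    adherent (fun u => S u /\ forall j, (j < m)%N -> l j u = 0) (x - \sum_(j < m) a j *: d j).
Proof.
move=> sS SH lS sQ QS; elim: m => [|m [d Qd IH]].
  exists (fun=> 0) => [_|x Qx]; first by case: sQ.
  by exists (fun=> 0); rewrite big_ord0 subr0; apply: sub_adherent (QS _ Qx).
pose Sm := fun u => S u /\ forall j, (j < m)%N -> l j u = 0.
(* The one-functional step needs all its points adherent to [Sm], which only the already corrected
   points of Q are known to be; hence the smaller [Q']. *)
pose Q' x := Q x /\ adherent Sm x.
have sSm : submodule Sm := submodule_ker_iter m sS lS.
have SmH u : Sm u -> H u by move=> [Su _]; exact: SH.
have sQ' : submodule Q'.
  split.
    split; first by case: sQ.
    split; first by case: sH.
    by move=> e e0; exists 0; split; [case: sSm|rewrite subrr -(scale0r 0) NZ ?/sqm /=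
      ?expr0n ?addr0 ?mul0r//; case: sH].
  move=> a x y [Qx adx] [Qy ady]; split; first by case: sQ => _; apply.
  by rewrite addrC -[a]opprK scaleNr; apply: adherentB.
have lSm : linear_on Sm (l m) by move=> a x y [Sx _] [Sy _]; exact: lS.
have [e [Qe _] He] := adherent_ker_codim1 sSm SmH lSm sQ' (fun x => @proj2 _ _).
exists (fun j => if j == m then e else d j) => [j|x Qx]; first by case: ifP.
have [a xa] := IH _ Qx.
have Qxa : Q (x - \sum_(j < m) a j *: d j).
  by rewrite -[X in _ - X]scale1r; apply: (submoduleB _ sQ) => //; exact: (submodule_sum _ _ sQ).
have [b xb] := He _ (conj Qxa xa).
exists (fun j => if j == m then b else a j).
rewrite big_ord_recr /= eqxx opprD addrA.
under eq_bigr => j _ do rewrite (ltn_eqF (ltn_ord j)).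
apply: sub_adherent xb => u [[Su lu] lmu]; split => // j.
by rewrite ltnS leq_eqVlt => /predU1P[->//|/lu].
Qed.

End Adherence.

(** * Vector-valued functions and the model space *)

Local Notation comp := Defs.comp.

Section VectorFunctions.
Context {R : realType} {n : nat}.
Local Notation C := R[i].
Local Notation Fn := (R -> 'cV[C]_n).
Local Notation mu := (@lebesgue_measure R).
Implicit Types (u v w h : Fn) (Th G : R -> 'M[C]_n).

Let mTc : measurable (Tc : set (measurableTypeR R)) := @measurable_Tc R.

Definition L2n u := forall i, L2 (comp u i).

Definition zmul u : Fn := fun t => expi t *: u t.

(** Agrees with [bshift] on functions with [at0 u = 0], and is moreover a linear isometry of all of
    (L^2)^n with inverse [zmul]. *)
Definition zbar u : Fn := fun t => expi (- t) *: u t.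

Definition N2 u : R := \sum_i I2 (comp u i).

Lemma conjcM (x y : C) : (x * y)^* = x^* * y^*.
Proof. by rewrite rmorphM. Qed.

Lemma compE a u v i : comp (a *: u + v) i = fun t => a * comp u i t + comp v i t.
Proof. by apply/funext => t; rewrite /comp /= !mxE. Qed.

Lemma comp0 i : comp (0 : Fn) i = fun=> 0.
Proof. by apply/funext => t; rewrite /comp mxE. Qed.

Lemma comp_zmul u i : comp (zmul u) i = fun t => expi t * comp u i t.
Proof. by apply/funext => t; rewrite /comp mxE. Qed.

Lemma comp_zbar u i : comp (zbar u) i = fun t => expi (- t) * comp u i t.
Proof. by apply/funext => t; rewrite /comp mxE. Qed.

Lemma comp_mulfun Th u i : comp (mulfun Th u) i = fun t => \sum_j Th t i j * comp u j t.
Proof. by apply/funext => t; rewrite /comp mxE. Qed.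

Lemma submodule_L2n : submodule L2n.
Proof.
split=> [i|a u v Lu Lv i]; first by rewrite comp0; exact: L2_cst.
by rewrite compE; apply: L2D => //; exact: L2Z.
Qed.

Lemma L2nB u v : L2n u -> L2n v -> L2n (u - v).
Proof. by move=> Lu Lv; rewrite -[v]scale1r; apply: (submoduleB _ submodule_L2n). Qed.

Lemma Linf_expi1 : Linf (fun t : R => expi t).
Proof. have := Linf_expi (1 : R); by under eq_fun => t do rewrite mul1r. Qed.

Lemma Linf_expiN1 : Linf (fun t : R => expi (- t)).
Proof. have := Linf_expi (- 1 : R); by under eq_fun => t do rewrite mulN1r. Qed.

Lemma L2n_zmul u : L2n u -> L2n (zmul u).
Proof. by move=> Lu i; rewrite comp_zmul; apply: L2_mul_Linf => //; exact: Linf_expi1. Qed.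

Lemma L2n_zbar u : L2n u -> L2n (zbar u).
Proof. by move=> Lu i; rewrite comp_zbar; apply: L2_mul_Linf => //; exact: Linf_expiN1. Qed.

Lemma zmulK u : zbar (zmul u) = u.
Proof. by apply/funext => t; rewrite /zbar /zmul scalerA expiVl scale1r. Qed.

Lemma zbarK u : zmul (zbar u) = u.
Proof. by apply/funext => t; rewrite /zbar /zmul scalerA mulrC expiVl scale1r. Qed.

Lemma zbarE a u v : zbar (a *: u + v) = a *: zbar u + zbar v.
Proof.
apply/funext => t; transitivity (a *: (expi (- t) *: u t) + expi (- t) *: v t) => //.
by rewrite /zbar scalerDr !scalerA mulrC.
Qed.

Lemma zbarB u v : zbar (u - v) = zbar u - zbar v.
Proof. by rewrite addrC -scaleN1r zbarE scaleN1r addrC. Qed.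

Lemma zbar0 : zbar 0 = 0.
Proof. by apply/funext => t; rewrite /zbar scaler0. Qed.

Lemma mulfunE Th a u v : mulfun Th (a *: u + v) = a *: mulfun Th u + mulfun Th v.
Proof. by apply/funext => t; rewrite /mulfun /= mulmxDr -scalemxAr. Qed.

Lemma mulfun0 Th : mulfun Th 0 = 0.
Proof. by apply/funext => t; rewrite /mulfun mulmx0. Qed.

Lemma mulfun_zmul Th u : mulfun Th (zmul u) = zmul (mulfun Th u).
Proof. by apply/funext => t; rewrite /mulfun -scalemxAr. Qed.

Lemma mulfun_zbar Th u : mulfun Th (zbar u) = zbar (mulfun Th u).
Proof. by apply/funext => t; rewrite /mulfun -scalemxAr. Qed.

Lemma I2D (f g : R -> C) : L2 f -> L2 g ->
  I2 (fun t => f t + g t) <= 2 * (I2 f + I2 g).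
Proof.
move=> Lf Lg; have [[mf jf] [mg jg]] := (Lf, Lg); have [_ jfg] := L2D Lf Lg.
rewrite /I2 -(RintegralD mTc jf jg).
rewrite -(RintegralZl 2 mTc); last exact: integrable_add.
apply: (le_Rintegral mTc) => //; last by move=> t _; exact: sqmD_le.
by apply: integrable_scale; exact: integrable_add.
Qed.

Lemma I2Z a (f : R -> C) : L2 f -> I2 (fun t => a * f t) = sqm a * I2 f.
Proof.
move=> [mf jf].
rewrite /I2 -(RintegralZl (sqm a) mTc jf).
by apply: eq_Rintegral => t _; rewrite sqmM.
Qed.

Lemma N2_ge0 u : 0 <= N2 u.
Proof. by apply: sumr_ge0 => i _; exact: I2_ge0. Qed.

Lemma N2D u v : L2n u -> L2n v -> N2 (u + v) <= 2 * (N2 u + N2 v).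
Proof.
move=> Lu Lv; rewrite /N2 -big_split mulr_sumr; apply: ler_sum => i _.
rewrite -[u]scale1r compE; under eq_fun do rewrite mul1r; rewrite scale1r; exact: I2D.
Qed.

Lemma N2Z a u : L2n u -> N2 (a *: u) = sqm a * N2 u.
Proof.
move=> Lu; rewrite /N2 mulr_sumr; apply: eq_bigr => i _; rewrite -I2Z//.
by congr I2; apply/funext => t; rewrite /comp mxE.
Qed.

Lemma N2_zbar u : N2 (zbar u) = N2 u.
Proof.
apply: eq_bigr => i _; rewrite comp_zbar; apply: eq_Rintegral => t _.
by rewrite sqmM sqm_expi mul1r.
Qed.

Lemma l2normE u : L2n u -> l2norm u = Num.sqrt (N2 u).
Proof.
move=> Lu; congr Num.sqrt; rewrite /N2 /I2.
under eq_Rintegral do (under eq_bigr do rewrite sqr_cmod).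
(* The real integrand is viewed as a complex one so that [cint_sum] can exchange sum and
   integral. *)
transitivity (complex.Re (cint (fun t => \sum_i (sqm (comp u i t))%:C))).
  by apply: eq_Rintegral => t _; rewrite (raddf_sum (@complex.Re R : {additive _ -> _})).
rewrite cint_sum; last first.
  by move=> i; split; [case: (Lu i)|case: (L1_cst (0 : C))].
by rewrite (raddf_sum (@complex.Re R : {additive _ -> _})).
Qed.

Lemma L1_ip u v : L2n u -> L2n v -> L1 (fun t => \sum_i u t i 0 * (v t i 0)^*).
Proof.
move=> Lu Lv; apply: L1_sum => i; apply: L2_mul; first exact: Lu.
apply: L2J; exact: Lv.
Qed.

Lemma ip_linear_l a u v w : L2n u -> L2n v -> L2n w ->
  ip (a *: u + v) w = a * ip u w + ip v w.
Proof.
move=> Lu Lv Lw; have Luw := L1_ip Lu Lw; have Lvw := L1_ip Lv Lw.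
rewrite /ip -cintZ// -cintD//; last exact: L1Z.
congr cint; apply/funext => t; rewrite mulr_sumr -big_split; apply: eq_bigr => i _.
by rewrite !mxE mulrDl mulrA.
Qed.

Lemma ipJ u v : L2n u -> L2n v -> ip v u = (ip u v)^*.
Proof.
move=> Lu Lv; rewrite /ip -cintJ; last exact: L1_ip.
congr cint; apply/funext => t; rewrite rmorph_sum; apply: eq_bigr => i _.
by rewrite rmorphM /= conjcK mulrC.
Qed.

Lemma ip_linear_r a u v w : L2n u -> L2n v -> L2n w ->
  ip u (a *: v + w) = a^* * ip u v + ip u w.
Proof.
move=> Lu Lv Lw; rewrite (ipJ _ Lu) ?ip_linear_l//; last by case: submodule_L2n => _; apply.
by rewrite rmorphD rmorphM /= (ipJ Lv Lu) (ipJ Lw Lu).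
Qed.

Lemma ip_zbar u v : ip (zbar u) v = ip u (zmul v).
Proof.
congr cint; apply/funext => t; apply: eq_bigr => i _.
by rewrite !mxE rmorphM /= expiN mulrCA mulrA.
Qed.

Lemma ip_zmul u v : ip (zmul u) (zmul v) = ip u v.
Proof. by rewrite -ip_zbar zmulK. Qed.

Definition Linfmx Th := forall i j, Linf (fun t => Th t i j).

Lemma L2n_mulfun Th u : Linfmx Th -> L2n u -> L2n (mulfun Th u).
Proof.
by move=> LT Lu i; rewrite comp_mulfun; apply: L2_sum => j; exact: L2_mul_Linf.
Qed.

Lemma L2n_mulfun_Linf G u : (forall i j, L2 (fun t => G t i j)) ->
  (forall i, Linf (comp u i)) -> L2n (mulfun G u).
Proof.
move=> LG Lu i; rewrite comp_mulfun; apply: L2_sum => j.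
by under eq_fun do rewrite mulrC; apply: L2_mul_Linf; [exact: Lu|exact: LG].
Qed.

Definition thcol Th j : Fn := fun t => col j (Th t).

Lemma L2n_thcol Th j : Linfmx Th -> L2n (thcol Th j).
Proof.
move=> LT i; have -> : comp (thcol Th j) i = fun t => Th t i j by apply/funext => t; rewrite /comp mxE.
exact: Linf_L2.
Qed.

Lemma L2n_cst (b : 'cV[C]_n) : L2n (fun=> b).
Proof. by move=> i; exact: L2_cst. Qed.

Lemma mulfun_cst Th (b : 'cV[C]_n) : mulfun Th (fun=> b) = \sum_j b j 0 *: thcol Th j.
Proof.
apply/funext => t; rewrite fct_sumE /mulfun; apply/matrixP => i k.
rewrite ord1 mxE summxE; apply: eq_bigr => j _.
by rewrite !mxE mulrC.
Qed.

Lemma ip_mulfun_cst Th u (b : 'cV[C]_n) : Linfmx Th -> L2n u ->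
  ip u (mulfun Th (fun=> b)) = \sum_j (b j 0)^* * ip u (thcol Th j).
Proof.
move=> LT Lu; rewrite mulfun_cst.
have H (s : seq 'I_n) : L2n (\sum_(j <- s) b j 0 *: thcol Th j) /\
    ip u (\sum_(j <- s) b j 0 *: thcol Th j) = \sum_(j <- s) (b j 0)^* * ip u (thcol Th j).
  elim: s => [|j s [Ls IH]].
    rewrite !big_nil; split; first by case: submodule_L2n.
    rewrite /ip -[RHS](mulr0 (2 * pi)%:C) -cint_cst; congr cint; apply/funext => t.
    by rewrite big1// => i _; rewrite mxE rmorph0 mulr0.
  rewrite !big_cons; split; first by case: submodule_L2n => _; apply => //; exact: L2n_thcol.
  by rewrite ip_linear_r ?IH//; exact: L2n_thcol.
by have [_] := H (index_enum _).
Qed.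

Lemma submodule_inHn (p : \bar R) : p = 2%:E \/ p = +oo%E -> submodule (@inHn R n p).
Proof.
move=> p2; have LL f : inL p f -> L2 f.
  by case: p2 => ->; [move/inL2P|move/inLooP/Linf_L2].
split=> [i|a u v Hu Hv i]; first rewrite comp0.
  split; last by move=> k; exact: analytic_cst.
  by case: p2 => ->; [apply/inL2P; exact: L2_cst|apply/inLooP; exact: Linf_cst].
have [[Lu Au] [Lv Av]] := (Hu i, Hv i); have [L2u L2v] := (LL _ Lu, LL _ Lv).
rewrite compE; split; last by apply: analyticD => //; [exact: L2Z|exact: analyticZ].
case: p2 Lu Lv => -> Lu Lv; first by apply/inL2P; apply: L2D => //; exact: L2Z.
move/inLooP: Lu => Lu; move/inLooP: Lv => Lv.
by apply/inLooP; apply: LinfD => //; apply: LinfM => //; exact: Linf_cst.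
Qed.

Lemma inHn2P u : inHn 2%:E u <-> L2n u /\ forall i, analytic (comp u i).
Proof.
split=> [Hu|[Lu Au] i]; last by split; [exact/inL2P|exact: Au].
by split => i; case: (Hu i) => [/inL2P].
Qed.

Lemma inHnooP u : inHn +oo%E u <->
  (forall i, Linf (comp u i)) /\ forall i, analytic (comp u i).
Proof.
split=> [Hu|[Lu Au] i]; last by split; [exact/inLooP|exact: Au].
by split => i; case: (Hu i) => [/inLooP].
Qed.

Lemma at0E u i : at0 u i 0 = fourier (comp u i) 0.
Proof. by rewrite mxE. Qed.

Lemma at0_linear a u v : L2n u -> L2n v -> at0 (a *: u + v) = a *: at0 u + at0 v.
Proof.
move=> Lu Lv; apply/matrixP => i k; rewrite !mxE compE fourierD ?fourierZ//.
exact: L2Z.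
Qed.

Lemma inHn2_zmul u : inHn 2%:E u -> inHn 2%:E (zmul u).
Proof.
move=> /inHn2P[Lu Au]; apply/inHn2P; split; first exact: L2n_zmul.
by move=> i; rewrite comp_zmul; exact: analytic_shift.
Qed.

Lemma analytic_comp_zbar u : (forall i, analytic (comp u i)) -> at0 u = 0 ->
  forall i, analytic (comp (zbar u) i).
Proof.
move=> Au u0 i; rewrite comp_zbar; apply: analytic_bshift => //.
by rewrite -at0E u0 mxE.
Qed.

Lemma inHn2_zbar u : inHn 2%:E u -> at0 u = 0 -> inHn 2%:E (zbar u).
Proof.
move=> /inHn2P[Lu Au] u0; apply/inHn2P; split; first exact: L2n_zbar.
exact: analytic_comp_zbar.
Qed.

Lemma inHnoo_zbar u : inHn +oo%E u -> at0 u = 0 -> inHn +oo%E (zbar u).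
Proof.
move=> /inHnooP[Lu Au] u0; apply/inHnooP; split; last exact: analytic_comp_zbar.
by move=> i; rewrite comp_zbar; apply: LinfM => //; exact: Linf_expiN1.
Qed.

Lemma inHn2_cst (b : 'cV[C]_n) : inHn 2%:E (fun=> b).
Proof.
apply/inHn2P; split; first exact: L2n_cst.
by move=> i; exact: analytic_cst.
Qed.

Lemma at0_cst (b : 'cV[C]_n) : at0 (fun=> b) = b.
Proof. by apply/matrixP => i k; rewrite ord1 at0E fourier_cst0. Qed.

(** Against constants only the zeroth coefficients of u count; the factor 2 pi reflects the
    unnormalised measure. *)
Lemma ip_cst_l (b : 'cV[C]_n) u : L2n u ->
  ip (fun=> b) u = (2 * pi)%:C * \sum_j (at0 u j 0)^* * b j 0.
Proof.
move=> Lu; rewrite /ip cint_sum; last by move=> i; apply/L1Z/L1J/L2_L1/Lu.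
rewrite mulr_sumr; apply: eq_bigr => j _.
rewrite cintZ; last exact/L1J/L2_L1/Lu.
rewrite cintJ; last exact/L2_L1/Lu.
rewrite at0E -/(comp u j) cint_fourier0 conjcM [X in _ * (X * _)](_ : _ = (2 * pi)%:C).
  by rewrite mulrC mulrA.
by rewrite /=; congr Complex; exact: oppr0.
Qed.

End VectorFunctions.

(** * The model space and division by z *)

Section ModelSpace.
Context {R : realType} {n : nat}.
Local Notation C := R[i].
Local Notation Fn := (R -> 'cV[C]_n).
Variable Th : R -> 'M[C]_n.
Hypothesis innerTh : is_matrix_inner Th.
Implicit Types (u v w h : Fn) (G : R -> 'M[C]_n).

Lemma inner_Linf : Linfmx Th.
Proof. by move=> i j; apply/inLooP; case: innerTh => H _; case: (H i j). Qed.

Lemma inHn2_mulfun_cst (b : 'cV[C]_n) : inHn 2%:E (mulfun Th (fun=> b)).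
Proof.
rewrite mulfun_cst; have sH : submodule (@inHn R n 2%:E) by apply: submodule_inHn; left.
have H (s : seq 'I_n) : inHn 2%:E (\sum_(j <- s) b j 0 *: thcol Th j).
  elim: s => [|j s IH]; first by rewrite big_nil; case: sH.
  rewrite big_cons; case: sH => _; apply => //.
  apply/inHn2P; split; first by apply: L2n_thcol; exact: inner_Linf.
  move=> i; have -> : comp (thcol Th j) i = fun t => Th t i j by apply/funext => t; rewrite /comp mxE.
  by case: innerTh => H _; case: (H i j).
exact: H.
Qed.

Lemma dot_mulmx (x y : 'cV[C]_n) :
  \sum_i x i 0 * (y i 0)^* = ((map_mx conjc y^T) *m x) 0 0.
Proof. by rewrite mxE; apply: eq_bigr => i _; rewrite !mxE mulrC. Qed.

(** Pointwise the integrand is v^* Th^* Th u, and Th^* Th = 1 almost everywhere. *)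
Lemma ip_mulfun u v : L2n u -> L2n v -> ip (mulfun Th u) (mulfun Th v) = ip u v.
Proof.
move=> Lu Lv; apply: cint_ae.
- by apply/cmeas_L1/L1_ip; apply: L2n_mulfun => //; exact: inner_Linf.
- by apply/cmeas_L1/L1_ip.
case: innerTh => _; apply: aeS => t + Tt => /(_ Tt)[_ U].
rewrite !dot_mulmx trmx_mul map_mxM -mulmxA [_ *m (Th t *m _)]mulmxA.
by rewrite [X in X *m u t](_ : _ = 1%:M) ?mul1mx// map_trmx.
Qed.

Lemma inK_L2n u : inK Th u -> L2n u.
Proof. by move=> [/inHn2P[]]. Qed.

Lemma submodule_inK : submodule (inK Th).
Proof.
have sH : submodule (@inHn R n 2%:E) by apply: submodule_inHn; left.
have LTh h : inHn 2%:E h -> L2n (mulfun Th h).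
  by move=> /inHn2P[Lh _]; apply: L2n_mulfun => //; exact: inner_Linf.
have [L0 _] := @submodule_L2n R n.
split; first split; first by case: sH.
  move=> h Hh; have := ip_linear_l (-1) L0 L0 (LTh _ Hh).
  by rewrite scaleN1r addNr mulN1r addNr.
move=> a u v Ku Kv; split; first by case: sH Ku Kv => _ sH [Hu _] [Hv _]; exact: sH.
move=> h Hh; rewrite ip_linear_l; [|exact: inK_L2n..|exact: LTh].
by case: Ku Kv => _ -> // [_ ->]//; rewrite mulr0 addr0.
Qed.

(** The adjoint of division by z is multiplication by z, which commutes with Th and preserves H^2,
    so <u / z, Th h> = <u, Th (z h)> = 0. *)
Lemma inK_zbar u : inK Th u -> at0 u = 0 -> inK Th (zbar u).
Proof.
move=> [Hu Ku] u0; split; first exact: inHn2_zbar.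
move=> h Hh; rewrite ip_zbar -mulfun_zmul; apply: Ku; exact: inHn2_zmul.
Qed.

(* [Th^* w] is orthogonal to H^2, so [z Th^* w] has no positive frequency:
   the projection of [z w] onto [Th H^2] is [Th b] with [b] constant. *)
Lemma inK_zmul_proj w : inK Th w ->
  inK Th (zmul w - mulfun Th (fun=> \col_j (((2 * pi)^-1)%:C * ip (zmul w) (thcol Th j)))).
Proof.
move=> Kw; have [Hw Kw'] := Kw; set b := \col_j _.
have sH : submodule (@inHn R n 2%:E) by apply: submodule_inHn; left.
have LTh h : L2n h -> L2n (mulfun Th h) by apply: L2n_mulfun; exact: inner_Linf.
have Lw := inK_L2n Kw; have Lzw := L2n_zmul Lw.
split.
  rewrite -[X in _ - X]scale1r; apply: (submoduleB _ sH); first exact: inHn2_zmul.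
  exact: inHn2_mulfun_cst.
move=> h Hh; have [Lh Ah] := (inHn2P h).1 Hh.
rewrite addrC -scaleN1r ip_linear_l//; [|exact/LTh/L2n_cst|exact: LTh].
rewrite mulN1r ip_mulfun//; last exact: L2n_cst.
(* Split h = h(0) + z s with s in H^2. The part z s contributes <z w, z Th s> = <w, Th s> = 0, and
   on the constant h(0) the factor (2 pi)^-1 in b cancels the 2 pi of [ip_cst_l]. *)
pose c : Fn := fun=> at0 h; pose s := zbar (h - c).
have Lc : L2n c by exact: L2n_cst.
have hE : h - c = -1 *: c + h by rewrite scaleN1r addrC.
have Hs : inHn 2%:E s.
  apply: inHn2_zbar; last by rewrite hE at0_linear// at0_cst scaleN1r addNr.
  by rewrite hE; case: sH => _; apply => //; exact: inHn2_cst.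
have [Ls _] := (inHn2P s).1 Hs.
have -> : mulfun Th h = 1 *: mulfun Th c + zmul (mulfun Th s).
  by rewrite -mulfun_zmul -mulfunE zbarK scale1r addrC subrK.
rewrite (ip_linear_r _ Lzw (LTh _ Lc) (L2n_zmul (LTh _ Ls))).
rewrite ip_zmul Kw'// addr0 rmorph1 mul1r ip_mulfun_cst//; last exact: inner_Linf.
rewrite ip_cst_l// mulr_sumr addrC -sumrB big1// => j _; rewrite [b j 0]mxE.
have E : (2 * pi)%:C * ((2 * pi)^-1)%:C = 1 :> C.
  by rewrite -rmorphM /= divff// gt_eqF// mulr_gt0 ?pi_gt0.
by rewrite mulrCA [X in _ - _ * X]mulrA E mul1r subrr.
Qed.

(** * The graph of f -> P(G f) on bounded functions *)

Section Projection.
Variable G : R -> 'M[C]_n.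
Hypothesis LG : forall i j, L2 (fun t => G t i j).

(** A set of pairs rather than a map: [projK] is a relation, so no projection operator has to be
    constructed, and closures of the graph make sense directly. *)
Definition mtto_graph (x : Fn * Fn) := inKinf Th x.1 /\ Defs.projK Th (mulfun G x.1) x.2.

Lemma inKinf_L2n_mulfun u : inKinf Th u -> L2n (mulfun G u).
Proof. by move=> [_ /inHnooP[Lu _]]; exact: L2n_mulfun_Linf. Qed.

Lemma submodule_mtto_graph : submodule mtto_graph.
Proof.
have sI : submodule (@inHn R n +oo%E) by apply: submodule_inHn; right.
have sK := submodule_inK.
have sKinf : submodule (inKinf Th).
  split; first by split; [case: sK|case: sI].
  by move=> a u v [Ku Iu] [Kv Iv]; split; [case: sK => _; apply|case: sI => _; apply].
have [L0 LD] := @submodule_L2n R n.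
have ip0 w : L2n w -> ip 0 w = 0.
  move=> Lw; have := ip_linear_l (-1) L0 L0 Lw.
  by rewrite scaleN1r addNr mulN1r addNr.
split.
  split => /=; first by case: sKinf.
  split; first by case: sK.
  move=> w Kw; have -> : (fun t => mulfun G 0 t - 0 t) = 0 :> Fn.
    by apply/funext => t; rewrite mulfun0 subr0.
  by rewrite ip0//; exact: inK_L2n.
move=> a [f v] [g w] /= [/= If [Kv Pv]] [/= Ig [Kw Pw]]; split => /=.
  by case: sKinf => _; apply.
split; first by case: sK => _; apply.
move=> k Kk; rewrite -[fun _ => _]/(mulfun G (a *: f + g) - (a *: v + w)).
have -> : mulfun G (a *: f + g) - (a *: v + w) =
    a *: (mulfun G f - v) + (mulfun G g - w).
  by rewrite mulfunE scalerBr opprD addrACA.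
rewrite ip_linear_l; [|by apply: L2nB; [exact: inKinf_L2n_mulfun|exact: inK_L2n]..|exact: inK_L2n].
by have -> := Pv _ Kk; have -> := Pw _ Kk; rewrite mulr0 addr0.
Qed.

Lemma mtto_graph_zbar f v : mtto_graph (f, v) -> at0 f = 0 -> at0 v = 0 ->
  (forall j, ip (mulfun G f) (thcol Th j) = 0) -> mtto_graph (zbar f, zbar v).
Proof.
move=> [/= If [Kv Pv]] f0 v0 c0; have [Kf Hf] := If.
have LGf := inKinf_L2n_mulfun If; have Lv := inK_L2n Kv.
split; first by split; [exact: inK_zbar|exact: inHnoo_zbar].
split; first exact: inK_zbar.
move=> w Kw; rewrite -[fun _ => _]/(mulfun G (zbar f) - zbar v).
have -> : mulfun G (zbar f) - zbar v = zbar (mulfun G f - v).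
  by rewrite mulfun_zbar zbarB.
rewrite ip_zbar; have := inK_zmul_proj Kw; set b := \col_j _ => Kw'.
have LU : L2n (mulfun G f - v) by exact: L2nB.
have LT := inner_Linf.
have -> : zmul w = 1 *: (zmul w - mulfun Th (fun=> b)) + mulfun Th (fun=> b).
  by rewrite scale1r subrK.
rewrite ip_linear_r//; [|exact: inK_L2n|by apply: L2n_mulfun => //; exact: L2n_cst].
have -> := Pv _ Kw'; rewrite mulr0 add0r ip_mulfun_cst// big1// => j _.
rewrite addrC -scaleN1r ip_linear_l//; last exact: L2n_thcol.
(* The coefficient <G f, Th e_j> vanishes by [c0]; <v, Th e_j> vanishes because v is orthogonal to
   Th H^2, which contains Th e_j. *)
rewrite c0 addr0; case: Kv => _ /(_ _ (inHn2_cst (delta_mx j 0))).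
rewrite mulfun_cst (bigD1 j)//= big1 ?addr0 => [|k kj]; last first.
  by rewrite mxE (negbTE kj) scale0r.
by rewrite mxE !eqxx scale1r => ->; rewrite !mulr0.
Qed.

End Projection.

End ModelSpace.

(** * The kernel of the truncated Toeplitz operator *)

Section Kernel.
Context {R : realType} {n : nat}.
Local Notation C := R[i].
Local Notation Fn := (R -> 'cV[C]_n).
Implicit Types (x y : Fn * Fn).

Definition L2pair x := L2n x.1 /\ L2n x.2.

Definition Npair x : R := N2 x.1 + N2 x.2.

Lemma submodule_L2pair : submodule L2pair.
Proof.
have [L0 LD] := @submodule_L2n R n.
split; first by split.
by move=> a x y [x1 x2] [y1 y2]; split; exact: LD.
Qed.

Lemma Npair_ge0 x : 0 <= Npair x.
Proof. by rewrite addr_ge0 ?N2_ge0. Qed.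

Lemma NpairD x y : L2pair x -> L2pair y -> Npair (x + y) <= 2 * (Npair x + Npair y).
Proof.
move=> [x1 x2] [y1 y2]; have := N2D x1 y1; have := N2D x2 y2; rewrite /Npair /=; lra.
Qed.

Lemma NpairZ (a : C) x : L2pair x -> Npair (a *: x) = sqm a * Npair x.
Proof. by move=> [x1 x2]; rewrite /Npair /= !N2Z// mulrDr. Qed.

Variables Th G : R -> 'M[C]_n.
Hypothesis innerTh : is_matrix_inner Th.
Hypothesis LG : forall i j, L2 (fun t => G t i j).

Local Notation graph := (mtto_graph Th G).
Local Notation adherent := (adherent L2pair Npair).

Lemma graph_L2pair x : graph x -> L2pair x.
Proof. by move=> [[Kx _] [Ky _]]; split; [exact: (inK_L2n Kx)|exact: (inK_L2n Ky)]. Qed.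

Lemma N2_small_cvg (u : nat -> Fn) : (forall k, L2n (u k)) ->
  (forall k, N2 (u k) < k.+1%:R^-1) -> l2norm (u k) @[k --> \oo] --> (0 : R).
Proof.
move=> Lu Nu; apply/cvgrPdist_lt => e e0; exists (Num.bound (e ^+ 2)^-1) => // k /= ek.
rewrite sub0r normrN ger0_norm ?sqrtr_ge0// l2normE// -(sqr_sqrtr (ltW e0)).
rewrite -[ltRHS]ger0_norm ?sqr_ge0// -sqrtr_sqr ltr_sqrt; last by rewrite exprn_gt0// sqr_sqrtr ?ltW.
rewrite sqr_sqrtr ?(ltW e0)//; apply: (lt_le_trans (Nu k)).
rewrite invf_ple ?posrE ?exprn_gt0//; apply: ltW; apply: (lt_le_trans (archi_boundP _)).
  by rewrite invr_ge0 sqr_ge0.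
by rewrite ler_nat leqW.
Qed.

Lemma cvg_N2_small (u : nat -> Fn) e : (forall k, L2n (u k)) -> 0 < e ->
  l2norm (u k) @[k --> \oo] --> (0 : R) ->
  exists K, forall k, (K <= k)%N -> N2 (u k) < e.
Proof.
move=> Lu e0 cu; have d0 : 0 < Num.sqrt e by rewrite sqrtr_gt0.
move/cvgrPdist_lt : cu => /(_ _ d0) [K _ uK]; exists K => k Kk.
have := uK k Kk; rewrite sub0r normrN ger0_norm ?sqrtr_ge0// l2normE//.
by rewrite ltr_sqrt.
Qed.

(** Sequences are traded for closures: in one direction a late enough index is taken, in the other
    approximants within 1 / (k + 1) are chosen for every k. *)
Lemma inKer_adherent f : inKer Th G f <-> inK Th f /\ adherent graph (f, 0).
Proof.
have [L0 _] := @submodule_L2n R n.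
split=> [[Kf [fk [vk [Ik Pk cf cv]]]]|[Kf [_ ad]]]; split => //.
  split; first by split; [exact: (inK_L2n Kf)|].
  move=> e e0; have d0 : 0 < e / 2 by lra.
  have Lf k : L2n (fk k - f) by apply: L2nB (inK_L2n Kf); case: (Ik k) => /inK_L2n.
  have Lv k : L2n (vk k - 0) by apply: L2nB L0; case: (Pk k) => /inK_L2n.
  have [K1 h1] := cvg_N2_small Lf d0 cf; have [K2 h2] := cvg_N2_small Lv d0 cv.
  pose k := maxn K1 K2; exists (fk k, vk k); split; first by split; [exact: Ik|exact: Pk].
  have := h1 k (leq_maxl _ _); have := h2 k (leq_maxr _ _); rewrite /Npair /=.
  by move: (N2 _) (N2 _) => a b; lra.
have Lf := inK_L2n Kf.
have /choice [u uP] k : exists u, graph u /\ Npair (u - (f, 0)) < k.+1%:R^-1.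
  by apply: ad; rewrite invr_gt0.
exists (fun k => (u k).1), (fun k => (u k).2).
have Lu k : L2pair (u k) by apply: graph_L2pair; case: (uP k).
split=> [k|k||]; [by case: (uP k) => -[]|by case: (uP k) => -[]|..].
  apply: (@N2_small_cvg (fun k => (u k).1 - f)) => k; first by apply: L2nB => //; case: (Lu k).
  by apply: le_lt_trans (uP k).2; rewrite /Npair /= lerDl N2_ge0.
apply: (@N2_small_cvg (fun k => (u k).2 - 0)) => k; first by apply: L2nB => //; case: (Lu k).
by apply: le_lt_trans (uP k).2; rewrite /Npair /= lerDr N2_ge0.
Qed.

Definition graph0 x := graph x /\ at0 x.1 = 0 /\ at0 x.2 = 0.

Lemma submodule_graph0 : submodule graph0.
Proof.
have sG := submodule_mtto_graph innerTh LG; have [L0 _] := @submodule_L2n R n.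
have z0 : at0 (0 : Fn) = 0 by have := at0_linear (-1) L0 L0; rewrite !scaleN1r !addNr.
split; first by split; [case: sG|].
move=> a x y [Gx [x1 x2]] [Gy [y1 y2]]; split; first by case: sG => _; apply.
have [Lx1 Lx2] := graph_L2pair Gx; have [Ly1 Ly2] := graph_L2pair Gy.
by rewrite /= !at0_linear// x1 x2 y1 y2 scaler0 addr0.
Qed.

(** Extends a family over ['I_n] by the zero functional, which is linear and bounded, to fit the
    lemmas on families indexed by [nat]. *)
Definition natfam (l : 'I_n -> Fn * Fn -> C) (j : nat) x : C :=
  oapp (fun i => l i x) 0 (insub j).

Lemma natfamE l (i : 'I_n) x : natfam l i x = l i x.
Proof. by rewrite /natfam valK. Qed.

Lemma linear_on_natfam S l : (forall i, linear_on S (l i)) ->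
  forall j, linear_on S (natfam l j).
Proof.
move=> lS j a x y Sx Sy; rewrite /natfam; case: insub => [i|] /=; first exact: lS.
by rewrite mulr0 addr0.
Qed.

Lemma sqm0 : sqm (0 : C) = 0.
Proof. by rewrite /sqm /= expr0n addr0. Qed.

(** The conditions are 2 n coordinate functionals, those of f(0) and of v(0), all bounded by
    [sqm_fourier0_le] and all zero at (f, 0); they are imposed in two rounds of n. *)
Lemma adherent_graph0 f : adherent graph (f, 0) -> at0 f = 0 -> adherent graph0 (f, 0).
Proof.
move=> ad f0; have [L0 _] := @submodule_L2n R n.
have z0 : at0 (0 : Fn) = 0 by have := at0_linear (-1) L0 L0; rewrite !scaleN1r !addNr.
have sH := submodule_L2pair; have sG := submodule_mtto_graph innerTh LG.
pose K : R := 2 * (2 * pi)^-1.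
have K0 : 0 <= K by rewrite mulr_ge0// invr_ge0 mulr_ge0 ?pi_ge0.
have bnd (u : Fn) (i : 'I_n) : L2n u -> sqm (at0 u i 0) <= K * N2 u.
  move=> Lu; rewrite at0E; apply: le_trans (sqm_fourier0_le (Lu i)) _.
  rewrite ler_wpM2l// /N2 (bigD1 i)//= lerDl; apply: sumr_ge0 => j _; exact: I2_ge0.
pose l1 (i : 'I_n) x := at0 x.1 i 0; pose l2 (i : 'I_n) x := at0 x.2 i 0.
have lin1 i : linear_on L2pair (l1 i).
  by move=> a x y [x1 _] [y1 _]; rewrite /l1 /= at0_linear// !mxE.
have lin2 i : linear_on L2pair (l2 i).
  by move=> a x y [_ x2] [_ y2]; rewrite /l2 /= at0_linear// !mxE.
have b1 j x : L2pair x -> sqm (natfam l1 j x) <= K * Npair x.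
  move=> [x1 x2]; rewrite /natfam; case: insub => [i|] /=; last first.
    by rewrite sqm0 mulr_ge0// Npair_ge0.
  by apply: le_trans (bnd _ _ x1) _; rewrite ler_wpM2l// lerDl N2_ge0.
have b2 j x : L2pair x -> sqm (natfam l2 j x) <= K * Npair x.
  move=> [x1 x2]; rewrite /natfam; case: insub => [i|] /=; last first.
    by rewrite sqm0 mulr_ge0// Npair_ge0.
  by apply: le_trans (bnd _ _ x2) _; rewrite ler_wpM2l// lerDr N2_ge0.
have v1 j : natfam l1 j (f, 0) = 0.
  by rewrite /natfam; case: insub => [i|] //=; rewrite /l1 /= f0 mxE.
have v2 j : natfam l2 j (f, 0) = 0.
  by rewrite /natfam; case: insub => [i|] //=; rewrite /l2 /= z0 mxE.
have ad1 := adherent_ker_continuous_iter sH Npair_ge0 NpairD NpairZ sG graph_L2pair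
  (linear_on_natfam lin1) b1 ad (m := n) (fun j _ => v1 j).
have sG1 := submodule_ker_iter n sG (linear_on_natfam (S := graph)
  (fun i a x y Gx Gy => lin1 i a x y (graph_L2pair Gx) (graph_L2pair Gy))).
have ad2 := adherent_ker_continuous_iter sH Npair_ge0 NpairD NpairZ sG1
  (fun x Gx => graph_L2pair Gx.1) (linear_on_natfam lin2) b2 ad1 (m := n) (fun j _ => v2 j).
apply: sub_adherent ad2 => x [[Gx x1] x2]; split => //; split.
  by apply/matrixP => i k; rewrite ord1 [RHS]mxE; have := x1 i (ltn_ord i); rewrite natfamE.
by apply/matrixP => i k; rewrite ord1 [RHS]mxE; have := x2 i (ltn_ord i); rewrite natfamE.
Qed.

Lemma ker_nearly_invariant : exists2 d : nat -> Fn,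
  (forall j, inHn 2%:E (d j)) &
  forall f, inKer Th G f -> at0 f = 0 -> exists (g : Fn) (c : nat -> C),
    inKer Th G g /\ zbar f = g + \sum_(j < n) c j *: d j.
Proof.
have sH := submodule_L2pair; have sG0 := submodule_graph0.
have sK := submodule_inK innerTh.
have G0H x : graph0 x -> L2pair x by move=> [/graph_L2pair].
pose l (i : 'I_n) x := ip (mulfun G x.1) (thcol Th i).
have LT := inner_Linf innerTh.
have lin i : linear_on graph0 (l i).
  move=> a x y [[Ix _] _] [[Iy _] _]; rewrite /l /= mulfunE.
  by rewrite (ip_linear_l _ (inKinf_L2n_mulfun LG Ix) (inKinf_L2n_mulfun LG Iy) (L2n_thcol i LT)).
(* Kernel vectors vanishing at 0, as pairs (f, 0). The functionals [l] are linear on [graph0] with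
   no bound at hand, so they are handled by the codimension count instead of the continuous case. *)
pose Q x := [/\ x.2 = 0, inK Th x.1, at0 x.1 = 0 & adherent graph0 x].
have sQ : submodule Q.
  have [[G00 [z1 _]] _] := sG0.
  split.
    split => //; first by case: sK.
    split; first by case: sH.
    move=> e e0; exists 0; split; first by case: sG0.
    by rewrite subrr -(scale0r 0) NpairZ ?sqm0 ?mul0r//; case: sH.
  move=> a x y [x2 Kx x1 adx] [y2 Ky y1 ady]; split.
  - by rewrite /= x2 y2 scaler0 addr0.
  - by case: sK => _; apply.
  - by rewrite /= at0_linear ?x1 ?y1 ?scaler0 ?addr0//; [exact: (inK_L2n Kx)|exact: (inK_L2n Ky)].
  - have := adherentB sH Npair_ge0 NpairD NpairZ (- a) sG0 G0H ady adx.
    by rewrite scaleNr opprK addrC.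
have [d Qd dP] := adherent_ker_codim sH Npair_ge0 NpairD NpairZ n sG0 G0H
  (linear_on_natfam lin) sQ (fun x Qx => let: And4 _ _ _ h := Qx in h).
exists (fun j => zbar (d j).1) => [j|f /inKer_adherent[Kf adf] f0].
  by case: (Qd j) => _ [Hd _] d0 _; exact: inHn2_zbar.
have Qf : Q (f, 0) by split => //; exact: adherent_graph0.
have [c adc] := dP _ Qf.
set y := _ - _ in adc.
have [y2 Ky y1 _] : Q y.
  have := submoduleB 1 sQ Qf (submodule_sum n c sQ Qd); by rewrite scale1r.
have yE : y.1 = f - (\sum_(j < n) c j *: d j).1 by [].
clearbody y; exists (zbar y.1), c; split.
  apply/inKer_adherent; split; first exact: inK_zbar.
  have [[Ly _] ad] := adc; split; first by split; [exact: L2n_zbar|case: (@submodule_L2n R n)].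
  (* Approximants of y satisfy every condition of [mtto_graph_zbar], so dividing them by z stays in
     the graph; the isometry keeps their distance to the limit. *)
  move=> e /ad[[u v] [[[Gu [/= u0 v0]] lu] uy]].
  exists (zbar u, zbar v); split.
    apply: mtto_graph_zbar => // j.
    by have := lu j (ltn_ord j); rewrite natfamE.
  apply: le_lt_trans uy; rewrite /Npair /= y2 !subr0 N2_zbar.
  by rewrite -zbarB N2_zbar.
have zs m : zbar (\sum_(j < m) c j *: d j).1 = \sum_(j < m) c j *: zbar (d j).1.
  elim: m => [|m IH]; first by rewrite !big_ord0 zbar0.
  by rewrite !big_ord_recr -IH [RHS]addrC -zbarE; congr zbar; exact: addrC.
rewrite -zs -[zbar y.1]scale1r -zbarE scale1r; congr zbar.
by rewrite yE subrK.
Qed.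

End Kernel.

(** The defect space is the span of the d_j; these n vectors may be dependent or zero, so its
    dimension is some m <= n. *)
Theorem theorem3p3 (R : realType) (n : nat) (Th G : R -> 'M[R[i]]_n)
  (p : \bar R) :
  is_matrix_inner Th -> (2%:E < p)%E -> inLmx p G -> is_MTTO Th G ->
  exists d : 'I_n -> R -> 'cV[R[i]]_n,
    (forall j, inHn 2%:E (d j)) /\
    forall f, inKer Th G f -> at0 f = 0 ->
      exists (g : R -> 'cV[R[i]]_n) (c : 'I_n -> R[i]),
        inKer Th G g /\
        {ae (@lebesgue_measure R), forall t, Tc t ->
           bshift f t = g t + \sum_j c j *: d j t}.
Proof.
move=> innerTh p2 LpG _.
have LG i j : L2 (fun t => G t i j) by exact: inL_L2 p2 (LpG i j).
have [d Hd dP] := ker_nearly_invariant innerTh LG.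
exists (fun j => d j); split=> [j|f Kf f0]; first exact: Hd.
have [g [c [Kg fE]]] := dP f Kf f0; exists g, (fun j => c j); split => //.
(* With f(0) = 0 the backward shift is plain division by z, and the decomposition holds at every
   point. *)
apply: aeW => t _; rewrite /bshift f0 subr0 -[LHS]/(zbar f t) fE /=.
by congr (_ + _); rewrite fct_sumE.
Qed.
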